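(* Let $\lambda\in\mathbb R$, let $\mathbf F\subset\mathcal P_2(\mathsf{TX})$ be a maximal totally $\lambda$-dissipative MPVF, let $T>0$ and $\mu_0\in D(\mathbf F)$. Let $(\mu^n_0)_{n\in\mathbb N}$ be a sequence in $D(\mathbf F)$ satisfying: (1) $\mu^n_0\to\mu_0$ in $\mathcal P_2(\mathsf X)$ as $n\to+\infty$; (2) $\sup_n|\mathbf F|_2(\mu^n_0)<+\infty$. If $\mathrm s^n,\mathrm s:\mathsf X\to C([0,T];\mathsf X)$ are the Lagrangian maps starting from $\mu^n_0$ and $\mu_0$ respectively, i.e. $\mathrm s^n[x](t)=\boldsymbol s_t(x,\mu_0^n)$ and $\mathrm s[x](t)=\boldsymbol s_t(x,\mu_0)$ (defined $\mu_0^n$-a.e. and $\mu_0$-a.e. respectively), then $$(\boldsymbol i,\mathrm s^n)_\sharp\mu^n_0\to(\boldsymbol i,\mathrm s)_\sharp\mu_0\quad\text{in }\mathcal P_2(\mathsf X\times C([0,T];\mathsf X))\quad\text{as }n\to+\infty.$$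
   Context: $\mathsf X$ is a separable (possibly infinite-dimensional) real Hilbert space; $\mathcal P_2(\cdot)$ denotes Borel probability measures with finite second moment (on $\mathsf X$, or on the separable Banach space $\mathsf X\times C([0,T];\mathsf X)$ with the sup norm on the second factor) with the $L^2$-Wasserstein distance. $\mathsf{TX}=\mathsf X\times\mathsf X$, $\mathsf x(x,v)=x$; $\boldsymbol i$ is the identity of $\mathsf X$. A multivalued probability vector field (MPVF) is a nonempty $\mathbf F\subset\mathcal P_2(\mathsf{TX})$, $D(\mathbf F)=\{\mathsf x_\sharp\Phi:\Phi\in\mathbf F\}$, $\mathbf F[\mu]=\{\Phi\in\mathbf F:\mathsf x_\sharp\Phi=\mu\}$. $\mathbf F$ is totally $\lambda$-dissipative if $\int\langle v_1-v_0,x_1-x_0\rangle\,d\vartheta\le\lambda\int|x_1-x_0|^2\,d\vartheta$ for every $\Phi_0,\Phi_1\in\mathbf F$ and every coupling $\vartheta\in\Gamma(\Phi_0,\Phi_1)$; maximal means maximal w.r.t. inclusion in this class. For $\mu\in D(\mathbf F)$, $\boldsymbol f^\circ[\mu]$ is the unique element of $L^2(\mathsf X,\mu;\mathsf X)$ such that $(\boldsymbol i,\boldsymbol f^\circ[\mu])_\sharp\mu\in\mathbf F[\mu]$ and $\int|\boldsymbol f^\circ[\mu]|^2d\mu\le\int|v|^2d\Phi$ for all $\Phi\in\mathbf F[\mu]$, and $|\mathbf F|_2(\mu)=\int|\boldsymbol f^\circ[\mu]|^2\,d\mu$. Let $(\Omega,\mathcal B,\mathbb P)$ be a standard Borel space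 with nonatomic probability, $\mathcal X=L^2(\Omega,\mathcal B,\mathbb P;\mathsf X)$, and $\boldsymbol B=\{(X,V)\in\mathcal X^2:(X,V)_\sharp\mathbb P\in\mathbf F\}$, a maximal $\lambda$-dissipative operator in $\mathcal X$ (i.e. $\langle V-W,X-Y\rangle\le\lambda|X-Y|^2$ on its graph, maximal w.r.t. inclusion). It generates a semigroup of $e^{\lambda t}$-Lipschitz maps $\boldsymbol S_t$ on $\overline{D(\boldsymbol B)}=\{X:X_\sharp\mathbb P\in\overline{D(\mathbf F)}\}$ such that for $X_0\in D(\boldsymbol B)$, $X_t=\boldsymbol S_tX_0$ is the unique locally Lipschitz solution of $\dot X_t\in\boldsymbol B(X_t)$ for a.e. $t>0$, $X_{t=0}=X_0$. The Lagrangian flow $\boldsymbol s_t:\{(x,\mu):\mu\in\overline{D(\mathbf F)},x\in\operatorname{supp}\mu\}\to\mathsf X$ is given by the uniquely defined continuous maps such that $(\boldsymbol S_tX)(\omega)=\boldsymbol s_t(X(\omega),X_\sharp\mathbb P)$ for $\mathbb P$-a.e. $\omega$ and every $X\in\overline{D(\boldsymbol B)}$. For $\mu_0\in D(\mathbf F)$ and $\mu_0$-a.e. $x$ the curve $t\mapsto\boldsymbol s_t(x,\mu_0)$ (in its $t$-continuous version) belongs to $H^1(0,T;\mathsf X)\subset C([0,T];\mathsf X)$, and $x\mapsto\mathrm s[x]$ is $\mu_0$-measurable. *)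

(* Defs.v *)
From HB Require Import structures.
From mathcomp Require Import all_boot all_order all_algebra.
From mathcomp Require Import sesquilinear.
From mathcomp Require Import all_classical all_reals all_analysis.

Set Implicit Arguments.
Unset Strict Implicit.
Unset Printing Implicit Defensive.

Import Order.TTheory GRing.Theory Num.Theory.
Import numFieldTopology.Exports numFieldNormedType.Exports.

Local Open Scope classical_set_scope.
Local Open Scope ring_scope.

Definition borel {R : realType} (Y : normedModType R) :=
  g_sigma_algebraType (@open Y).

Definition Prob {R : realType} (Y : normedModType R) :=
  probability (borel Y) R.

Definition separable (Y : topologicalType) :=
  exists2 D : set Y, countable D & dense D.

(* The Banach space C([0,T]; X), normed by the supremum of the norm. *)
Section continuous_paths.
Context {R : realType} (T : R) (X : normedModType R).

Definition cpath : Type := continuousType (set_type `[0, T]%classic) X.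

HB.instance Definition _ := Choice.on cpath.

Implicit Types f g : cpath.

Let cpathP f g : f =1 g -> f = g.
Proof. by move=> fg; apply/continuousEP. Qed.

Let cst0_continuous : continuous (fun _ : set_type `[0, T]%classic => 0 : X).
Proof. exact: cst_continuous. Qed.

Let opp_continuous f : continuous (fun t => - f t).
Proof.
by move=> t; have cf : {for t, continuous f} := cts_fun t; exact: (cvgN cf).
Qed.

Let add_continuous f g : continuous (fun t => f t + g t).
Proof.
move=> t; have cf : {for t, continuous f} := cts_fun t.
have cg : {for t, continuous g} := cts_fun t.
exact: (cvgD cf cg).
Qed.

Let scale_continuous (k : R) f : continuous (fun t => k *: f t).
Proof.
move=> t; have cf : {for t, continuous f} := cts_fun t.
exact: (@cvgZ _ _ _ _ _ (fun=> k) _ _ _ (cvg_cst k) cf).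
Qed.

Definition cpath0 : cpath := mkcts cst0_continuous.
Definition cpath_opp f : cpath := mkcts (@opp_continuous f).
Definition cpath_add f g : cpath := mkcts (@add_continuous f g).
Definition cpath_scale (k : R) f : cpath := mkcts (@scale_continuous k f).

Let cpath_addA : associative cpath_add.
Proof. by move=> f g h; apply: cpathP => t /=; rewrite /mkcts /= addrA. Qed.
Let cpath_addC : commutative cpath_add.
Proof. by move=> f g; apply: cpathP => t /=; rewrite /mkcts addrC. Qed.
Let cpath_add0 : left_id cpath0 cpath_add.
Proof. by move=> f; apply: cpathP => t /=; rewrite /mkcts add0r. Qed.
Let cpath_addN : left_inverse cpath0 cpath_opp cpath_add.
Proof. by move=> f; apply: cpathP => t /=; rewrite /mkcts addNr. Qed.

HB.instance Definition _ :=
  GRing.isZmodule.Build cpath cpath_addA cpath_addC cpath_add0 cpath_addN.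

Let cpath_scaleA a b f : cpath_scale a (cpath_scale b f) = cpath_scale (a * b) f.
Proof. by apply: cpathP => t /=; rewrite /mkcts scalerA. Qed.
Let cpath_scale1 : left_id 1 cpath_scale.
Proof. by move=> f; apply: cpathP => t /=; rewrite /mkcts scale1r. Qed.
Let cpath_scaleDr : right_distributive cpath_scale +%R.
Proof. by move=> k f g; apply: cpathP => t /=; rewrite /mkcts /= scalerDr. Qed.
Let cpath_scaleDl f : {morph cpath_scale^~ f : a b / a + b}.
Proof. by move=> a b; apply: cpathP => t /=; rewrite /mkcts /= scalerDl. Qed.

HB.instance Definition _ := GRing.Zmodule_isLmodule.Build R cpath
  cpath_scaleA cpath_scale1 cpath_scaleDr cpath_scaleDl.


Definition cpath_norm f : R := sup (range (fun t => `|f t|)).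

Let cpath_has_ubound f : has_ubound (range (fun t => `|f t|)).
Proof.
have cf : {within `[0, T]%classic, continuous (valL f)}.
  by apply/subspace_valL_continuousP; exact: cts_fun.
have /compact_bounded[M [_ fM]] :=
  continuous_compact cf (@segment_compact R 0 T).
exists (M + 1) => _ [t _ <-]; apply: fM; first by rewrite ltrDl.
by exists (set_val t); [exact: set_valP|rewrite -[in RHS](valLK point f)].
Qed.

Let cpath_norm_ub f t : `|f t| <= cpath_norm f.
Proof. by apply: ub_le_sup; [exact: cpath_has_ubound|exists t]. Qed.

Let cpath_norm_le f (c : R) :
  0 <= c -> (forall t, `|f t| <= c) -> cpath_norm f <= c.
Proof.
move=> c0 fc; have [r0|/set0P r0] := eqVneq (range (fun t => `|f t|)) set0.
  by rewrite /cpath_norm r0 sup0.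
by apply: ge_sup => // _ [t _ <-].
Qed.

Let cpath_norm_ge0 f : 0 <= cpath_norm f.
Proof.
have [r0|/set0P[_ [t _ _]]] := eqVneq (range (fun t => `|f t|)) set0.
  by rewrite /cpath_norm r0 sup0.
exact: le_trans (cpath_norm_ub f t).
Qed.

Let cpath_ler_normD f g : cpath_norm (f + g) <= cpath_norm f + cpath_norm g.
Proof.
apply: cpath_norm_le => [|t]; first by rewrite addr_ge0 ?cpath_norm_ge0.
by rewrite (le_trans (ler_normD _ _))// lerD ?cpath_norm_ub.
Qed.

Let cpath_norm_scale_le (k : R) f : cpath_norm (k *: f) <= `|k| * cpath_norm f.
Proof.
apply: cpath_norm_le => [|t]; first by rewrite mulr_ge0 ?cpath_norm_ge0.
by rewrite normrZ ler_wpM2l ?cpath_norm_ub.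
Qed.

Let cpath_normZ (k : R) f : cpath_norm (k *: f) = `|k| * cpath_norm f.
Proof.
apply/eqP; rewrite eq_le cpath_norm_scale_le /=.
have [->|k0] := eqVneq k 0; first by rewrite normr0 mul0r cpath_norm_ge0.
rewrite -ler_pdivlMl ?normr_gt0// -normfV.
by rewrite -{1}[f](scalerK k0) cpath_norm_scale_le.
Qed.

Let cpath_norm_eq0 f : cpath_norm f = 0 -> f = 0.
Proof.
move=> f0; apply: cpathP => t; apply/eqP; rewrite -normr_le0.
by have := cpath_norm_ub f t; rewrite f0.
Qed.

HB.instance Definition _ := Lmodule_isNormed.Build R cpath
  cpath_ler_normD cpath_normZ cpath_norm_eq0.

End continuous_paths.

Section transport.
Context {R : realType}.

(* [f] need only be measurable modulo a [mu]-negligible set, so that it may be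
   an almost everywhere defined map, extended arbitrarily. *)
Definition ae_measurable d d' (S : measurableType d) (S' : measurableType d')
    (mu : probability S R) (f : S -> S') :=
  exists2 g : S -> S', measurable_fun [set: S] g &
    {ae mu, forall x, f x = g x}.

(* [is_pushforward mu f nu]: [f] is [mu]-measurable and [nu] is the image of
   [mu] by [f]. Measures are compared on measurable sets only, because the
   value of a Rocq measure on other sets is irrelevant. *)
Definition is_pushforward d d' (S : measurableType d) (S' : measurableType d')
    (mu : probability S R) (f : S -> S') (nu : probability S' R) :=
  exists g : S -> S', [/\ measurable_fun [set: S] g,
    {ae mu, forall x, f x = g x} &
    forall A, measurable A -> nu A = mu (g @^-1` A)].

Section wasserstein.
Variable Y : normedModType R.
Implicit Types mu nu : Prob Y.

Definition P2 : set (Prob Y) :=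
  [set mu : Prob Y | (\int[mu]_y (`|y : Y| ^+ 2)%:E < +oo)%E].

Definition couplings mu nu : set (Prob (Y * Y)%type) :=
  [set gamma : Prob (Y * Y)%type |
    is_pushforward gamma (fst : borel (Y * Y)%type -> borel Y) mu /\
    is_pushforward gamma (snd : borel (Y * Y)%type -> borel Y) nu].

Definition W2 mu nu : \bar R :=
  ((ereal_inf [set \int[gamma]_z (`|(z : Y * Y).1 - (z : Y * Y).2| ^+ 2)%:E
              | gamma in couplings mu nu]) `^ 2^-1)%E.

Definition cvg_P2 (mu_ : nat -> Prob Y) mu :=
  [/\ forall n, P2 (mu_ n), P2 mu & W2 (mu_ n) mu @[n --> \oo] --> 0%E].

Definition msupport mu : set Y :=
  [set x | forall U : set Y, open U -> U x -> (0 < mu U)%E].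

End wasserstein.

Section Lebesgue2.
Variables (d : measure_display) (S : measurableType d) (mu : probability S R).
Variable X : normedModType R.
Implicit Types f g : S -> X.

(* Elements of L^2(S, mu; X) are represented by measurable functions;
   equality of classes is almost everywhere equality. *)
Definition L2 : set (S -> X) :=
  [set f | measurable_fun [set: S] (f : S -> borel X) /\
           (\int[mu]_x (`|f x| ^+ 2)%:E < +oo)%E].

Definition L2dist f g : \bar R :=
  ((\int[mu]_x (`|f x - g x| ^+ 2)%:E) `^ 2^-1)%E.

Definition ae_equal f g := {ae mu, forall x, f x = g x}.

End Lebesgue2.

End transport.

Section spaces.
Context {R : realType} (d : measure_display) (Omega : measurableType d).

(* isomorphic, as a measurable space, to a Polish space *)
Definition standard_borel :=
  exists Y : completePseudoMetricType R,
    [/\ hausdorff_space Y, separable Y &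
        exists2 f : Omega -> Y, bijective f &
          forall A : set Omega, measurable A <-> <<s @open Y >> (f @` A)].

Definition nonatomic (P : probability Omega R) :=
  forall A, measurable A -> (0 < P A)%E ->
    exists B, [/\ measurable B, B `<=` A, (0 < P B)%E & (P B < P A)%E].

End spaces.

Section mpvf.
Context {R : realType} {X : completeNormedModType R}.
Variables (ip : {dot X for idfun}) (lam : R).

(* The tangent bundle TX = X * X carries the max norm of the library, which is
   equivalent to the Hilbert norm: the Borel sets and the condition of finite
   second moment are the same. *)
Let TX : normedModType R := (X * X)%type.

Implicit Types (F : set (Prob TX)) (mu : Prob X).

Definition is_mpvf F := F !=set0 /\ F `<=` @P2 R TX.

Definition fiber F mu : set (Prob TX) :=
  [set Phi | F Phi /\ is_pushforward Phi (fst : borel TX -> borel X) mu].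

Definition domain F : set (Prob X) := [set mu | fiber F mu !=set0].

Definition domain_closure F : set (Prob X) :=
  [set mu | P2 mu /\
    forall e : R, 0 < e -> exists2 nu, domain F nu & (W2 mu nu < e%:E)%E].

Definition totally_dissipative F :=
  forall Phi0 Phi1, F Phi0 -> F Phi1 ->
  forall theta, couplings Phi0 Phi1 theta ->
    (\int[theta]_z (ip ((z : TX * TX).2.2 - (z : TX * TX).1.2)
                       ((z : TX * TX).2.1 - (z : TX * TX).1.1))%:E <=
     lam%:E * \int[theta]_z (`|(z : TX * TX).2.1 - (z : TX * TX).1.1| ^+ 2)%:E)%E.

Definition maximal_totally_dissipative F :=
  [/\ is_mpvf F, totally_dissipative F &
      forall G, is_mpvf G -> totally_dissipative G -> F `<=` G -> G = F].

Definition is_minimal_selection F mu (f : X -> X) :=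
  [/\ L2 mu f,
      exists2 Phi, fiber F mu Phi &
        is_pushforward mu (fun x => (x, f x) : borel TX) Phi &
      forall Phi, fiber F mu Phi ->
        (\int[mu]_x (`|f x| ^+ 2)%:E <=
         \int[Phi]_z (`|(z : TX).2| ^+ 2)%:E)%E].

(* |F|_2(mu), where [fo mu] is the minimal selection of F at mu; following the
   convention of the source, no square root is taken. *)
Definition mpvf_norm2 (fo : Prob X -> X -> X) mu : \bar R :=
  (\int[mu]_x (`|fo mu x| ^+ 2)%:E)%E.

Section lagrangian.
Variables (d : measure_display) (Omega : measurableType d).
Variable (P : probability Omega R).
Implicit Types (Z V : Omega -> X).

Definition lift_op F : set ((Omega -> X) * (Omega -> X)) :=
  [set ZV | [/\ L2 P ZV.1, L2 P ZV.2 &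
    exists2 Phi, F Phi &
      is_pushforward P (fun w => (ZV.1 w, ZV.2 w) : borel TX) Phi]].

Definition lift_domain F : set (Omega -> X) :=
  [set Z | exists V, lift_op F (Z, V)].

Definition lift_domain_closure F : set (Omega -> X) :=
  [set Z | L2 P Z /\
    forall e : R, 0 < e -> exists2 Y, lift_domain F Y & (L2dist P Z Y < e%:E)%E].

(* [x] is a locally Lipschitz curve in L^2(Omega, P; X), differentiable at
   almost every t > 0 with derivative in the operator, and starting from [Z]. *)
Definition is_solution F (x : R -> Omega -> X) Z :=
  [/\ ae_equal P (x 0) Z,
      forall t, 0 <= t -> L2 P (x t),
      forall b : R, exists L : R, forall s t, 0 <= s <= b -> 0 <= t <= b ->
        (L2dist P (x s) (x t) <= (L * `|s - t|)%:E)%E &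
      {ae @lebesgue_measure R, forall t, 0 < t ->
        exists2 V, lift_op F (x t, V) &
          L2dist P (fun w => h^-1 *: (x (t + h) w - x t w)) V @[h --> 0^']
            --> 0%E}].

(* The semigroup generated by the lifted operator, on representatives. *)
Definition is_semigroup F (S : R -> (Omega -> X) -> Omega -> X) :=
  [/\ forall t Z, 0 <= t -> lift_domain_closure F Z ->
        lift_domain_closure F (S t Z),
      forall Z, lift_domain_closure F Z -> ae_equal P (S 0 Z) Z,
      forall s t Z, 0 <= s -> 0 <= t -> lift_domain_closure F Z ->
        ae_equal P (S (s + t) Z) (S s (S t Z)),
      forall t Z Y, 0 <= t ->
        lift_domain_closure F Z -> lift_domain_closure F Y ->
        (L2dist P (S t Z) (S t Y) <= (expR (lam * t))%:E * L2dist P Z Y)%E &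
      forall Z, lift_domain F Z ->
        is_solution F (fun t => S t Z) Z /\
        forall y, is_solution F y Z ->
          forall t, 0 <= t -> ae_equal P (y t) (S t Z)].

Definition is_lagrangian_flow F (S : R -> (Omega -> X) -> Omega -> X)
    (s : R -> X -> Prob X -> X) :=
  (forall t x mu, 0 <= t -> domain_closure F mu -> msupport mu x ->
     forall e : R, 0 < e -> exists2 r : R, 0 < r &
       forall y nu, domain_closure F nu -> msupport nu y ->
         `|x - y| < r -> (W2 mu nu < r%:E)%E -> `|s t x mu - s t y nu| < e) /\
  (forall t Z mu, 0 <= t -> lift_domain_closure F Z ->
     is_pushforward P (Z : Omega -> borel X) mu ->
     {ae P, forall w, S t Z w = s t (Z w) mu}).

End lagrangian.

Definition is_lagrangian_map (s : R -> X -> Prob X -> X) (T : R) mu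
    (f : X -> cpath T X) :=
  ae_measurable mu (f : borel X -> borel (cpath T X)) /\
  {ae mu, forall x, forall t : set_type `[0, T]%classic,
    f x t = s (set_val t) x mu}.

End mpvf.

(* Main.v *)
(* Realize a coupling of [mu0_ n] and [mu0] of small cost as the law of a pair
   [(Z, Y)] on [Omega]. At fixed times the paths from [Z] and [Y] stay close in
   [L^2] because the semigroup is [exp (lam t)]-Lipschitz. Dissipativity and the
   bound on the minimal selections make them Lipschitz in time with values in
   [L^2], with a uniform constant, so dyadic chaining upgrades the closeness at
   the dyadic times of one level to closeness in [L^2(Omega; C([0, T]; X))]. *)
Require Import Defs.
From HB Require Import structures.
From mathcomp Require Import all_boot all_order all_algebra.
From mathcomp Require Import sesquilinear.
From mathcomp Require Import all_classical all_reals all_analysis.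
From mathcomp Require Import measurable_realfun zify ring lra.

Set Implicit Arguments.
Unset Strict Implicit.
Unset Printing Implicit Defensive.

Import Order.TTheory GRing.Theory Num.Theory.
Import numFieldTopology.Exports numFieldNormedType.Exports.
Local Open Scope classical_set_scope.
Local Open Scope ring_scope.

(** * Nonatomic probabilities *)

(** The contraction of the semigroup bounds a supremum over [t] of expectations, whereas the
    statement needs the expectation of a supremum, and in infinite dimension there is no compactness
    to pass from one to the other. Hence a quantitative estimate with two scales. At level [m] the
    grid costs about [2 ^+ m] times the squared distance of the initial laws, and the oscillation
    between grid times costs about [2 ^- m] times the bound on the minimal selections: [m] is fixed
    first, then the distance is made small. The chaining series converges because the [2 ^+ k]
    squared increments at level [k] of a Lipschitz curve sum to order [2 ^- k]. The Lipschitz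
    constant comes from the differential inclusion alone: dissipativity against the fixed pair
    [(Z, V)] bounds the derivative of the squared distance to the starting point, and the
    contraction carries this short-time bound to later times. The semigroup acts on random variables
    and couplings are measures on [X * X], so they must be realized on the given [Omega].
    Nonatomicity supplies subsets of every intermediate probability, from which a law on a separable
    complete space is built by discrete approximation. *)

Section nonatomic_probability.
Context {R : realType} (d : measure_display) (Omega : measurableType d).
Variable P : probability Omega R.

Let p (A : set Omega) : R := fine (P A).

Lemma fine_probE A : measurable A -> P A = (fine (P A))%:E.
Proof. by move=> mA; rewrite fineK// fin_num_measure. Qed.

Lemma fine_prob_ge0 A : 0 <= fine (P A).
Proof. exact: fine_ge0. Qed.

Lemma le_fine_prob A B : measurable A -> measurable B -> A `<=` B ->
  fine (P A) <= fine (P B).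
Proof.
move=> mA mB AB; rewrite -lee_fin -!fine_probE//.
by apply: le_measure => //; rewrite inE.
Qed.

Lemma fine_probU A B : measurable A -> measurable B -> A `&` B = set0 ->
  fine (P (A `|` B)) = fine (P A) + fine (P B).
Proof.
move=> mA mB AB; apply: EFin_inj; rewrite EFinD -!fine_probE//.
  exact: measureU.
exact: measurableU.
Qed.

Lemma fine_probD A B : measurable A -> measurable B -> B `<=` A ->
  fine (P (A `\` B)) = fine (P A) - fine (P B).
Proof.
move=> mA mB BA; apply/eqP; rewrite eq_sym subr_eq -fine_probU//.
- by rewrite setUC setDUK.
- exact: measurableD.
- by rewrite setIC setDIK.
Qed.

Hypothesis P_nonatomic : nonatomic P.

(** When [A] is split into two pieces of positive mass, one of them has at most half of the mass;
    [n] splittings suffice once [p A <= 2 ^+ n * e]. *)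
Lemma nonatomic_small_subset A (e : R) : measurable A -> 0 < p A -> 0 < e ->
  exists B, [/\ measurable B, B `<=` A, 0 < p B & p B <= e].
Proof.
move=> mA pA e0.
have [n ne] : exists n, p A <= 2 ^+ n * e.
  have ne := archi_boundP (ltW (divr_gt0 pA e0)).
  exists (Num.bound (p A / e)).
  rewrite -ler_pdivrMr// (le_trans (ltW ne))//.
  by rewrite -natrX ler_nat ltnW// ltn_expl.
elim: n A mA pA ne => [|n IHn] A mA pA ne.
  by exists A; split=> //; rewrite expr0 mul1r in ne.
have [B [mB BA PB0 PBA]] : exists B,
    [/\ measurable B, B `<=` A, 0 < p B & p B < p A].
  have [|B [mB BA B0 BltA]] := P_nonatomic mA; first by rewrite fine_probE.
  exists B; split=> //; first by rewrite -lte_fin -fine_probE.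
  by rewrite -lte_fin -!fine_probE.
have [pB|pB] := leP (p B) (p A / 2).
  have [|C [mC CB pC Ce]] := IHn B mB PB0.
    by rewrite (le_trans pB)// ler_pdivrMr// mulrAC -exprSr.
  by exists C; split=> //; exact: subset_trans BA.
have mAB := measurableD mA mB.
have pAB := fine_probD mA mB BA; rewrite -!/(p _) in pAB.
have [||C [mC CB pC Ce]] := IHn (A `\` B) mAB.
  by rewrite pAB subr_gt0.
  rewrite pAB (@le_trans _ _ (p A / 2))//.
    lra.
  by rewrite ler_pdivrMr// mulrAC -exprSr.
by exists C; split=> //; apply: (subset_trans CB) => x [].
Qed.

(* Sierpinski's theorem: greedily add subsets at least half as large as the
   largest one which still fits; a leftover would fit at every stage. *)
Lemma nonatomic_subset A (c : R) : measurable A -> 0 <= c <= p A ->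
  exists B, [/\ measurable B, B `<=` A & p B = c].
Proof.
move=> mA /andP[c0 cA].
pose cand B := [set C | [/\ measurable C, C `<=` A `\` B & p C <= c - p B]].
have cand0 B : p B <= c -> cand B set0.
  by move=> Bc; split=> //; rewrite /p measure0/= subr_ge0.
have /choice[step stepP] B : exists C, p B <= c ->
    cand B C /\ forall D, cand B D -> p D <= 2 * p C.
  have [Bc|] := pselect (p B <= c); last by exists set0.
  have ub : has_ubound (p @` cand B).
    by exists (c - p B) => _ [C [_ _ ?] <-].
  have ne : (p @` cand B) !=set0 by exists (p set0), set0 => //; exact: cand0.
  have [s0|s0] := ltP 0 (sup (p @` cand B)).
    have [_ [C Cc <-] sC] := sup_adherent (divr_gt0 s0 (ltr0Sn _ 1)) (conj ne ub).
    exists C => _; split=> // D Dc.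
    have := ub_le_sup ub (imageP p Dc); lra.
  exists set0 => _; split; first exact: cand0.
  move=> D Dc; rewrite /p measure0/= mulr0.
  exact: le_trans (ub_le_sup ub (imageP p Dc)) s0.
pose B_ := fix B n := if n is n'.+1 then B n' `|` step (B n') else set0.
have B_P n : [/\ measurable (B_ n), B_ n `<=` A & p (B_ n) <= c].
  elim: n => [|n [mB BA Bc]]; first by split=> //=; rewrite /p measure0.
  have [[mC CAB Cc] _] := stepP _ Bc; split => /=.
  - exact: measurableU.
  - by move=> x [/BA//|/CAB[]].
  - rewrite /p fine_probU//; first by rewrite addrC -lerBrDr.
    by rewrite setIC -subset0 => x [/CAB[]].
have BS n : p (B_ n.+1) = p (B_ n) + p (step (B_ n)).
  have [mB BA Bc] := B_P n; have [[mC CAB _] _] := stepP _ Bc.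
  by rewrite /p/= fine_probU// setIC -subset0 => x [/CAB[]].
have mB n : measurable (B_ n) by have [] := B_P n.
have mUB : measurable (\bigcup_n B_ n) by apply: bigcupT_measurable.
have UBA : \bigcup_n B_ n `<=` A by apply: bigcup_sub => n _; have [] := B_P n.
have UBc : p (\bigcup_n B_ n) <= c.
  rewrite -lee_fin -fine_probE//.
  have ndB : nondecreasing_seq B_.
    by apply/nondecreasing_seqP => n; apply/subsetPset => x; left.
  have cB := @nondecreasing_cvg_mu _ _ _ P _ mB mUB ndB.
  rewrite -(cvg_lim _ cB)//; apply: lime_le; first exact: cvgP cB.
  by near=> n; rewrite /= fine_probE// lee_fin; have [] := B_P n.
exists (\bigcup_n B_ n); split=> //.
apply/eqP; rewrite eq_le UBc/= leNgt; apply/negP => ltc.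
have mD := measurableD mA mUB.
have [||D [mD' DA D0 Dc]] := @nonatomic_small_subset _ (c - p (\bigcup_n B_ n)) mD.
- by rewrite /p fine_probD// subr_gt0 (lt_le_trans ltc).
- by rewrite subr_gt0.
have Dcand n : cand (B_ n) D.
  split=> //.
    by move=> x /DA[Ax nB]; split=> // Bx; apply: nB; exists n.
  rewrite (le_trans Dc)// lerB// le_fine_prob//.
  exact: (@bigcup_sup _ _ n).
(* Since [D] remains a candidate, every stage gains at least half of [p D]; by the Archimedean
   property the total would exceed [c]. *)
have Bge n : n%:R * p D <= 2 * p (B_ n).
  elim: n => [|n IHn]; first by rewrite mul0r /p measure0 mulr0.
  rewrite BS mulrDr -natr1 mulrDl mul1r lerD//.
  have [_ _ Bc] := B_P n; have [_] := stepP _ Bc; exact.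
have := Bge (Num.bound (2 * c / p D)).
have [_ _ Bc] := B_P (Num.bound (2 * c / p D)).
apply/negP; rewrite -ltNge (@le_lt_trans _ _ (2 * c))//.
  by rewrite ler_wpM2l.
by rewrite -ltr_pdivrMr// archi_boundP// divr_ge0// ?mulr_ge0// ltW.
Unshelve. all: by end_near. Qed.

End nonatomic_probability.

(** * Borel measurability in normed spaces *)

Section borel_measurability.
Context {R : realType}.
Implicit Types Y : normedModType R.

Lemma measurable_open Y (U : set Y) : open U -> measurable (U : set (borel Y)).
Proof. by move=> oU; apply: sub_sigma_algebra. Qed.

Lemma measurable_closed Y (U : set Y) :
  closed U -> measurable (U : set (borel Y)).
Proof.
move=> cU; have := measurableC (measurable_open (closed_openC cU)).
by rewrite setCK.
Qed.

Lemma measurable_borelP d (S : measurableType d) Y (f : S -> Y) :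
  (forall U, open U -> measurable (f @^-1` U)) ->
  measurable_fun [set: S] (f : S -> borel Y).
Proof.
move=> fU; apply: (@measurability _ _ S (borel Y) setT f (@open Y)) => //.
by move=> _ [U oU <-]; rewrite setTI; exact: fU.
Qed.

Lemma continuous_borel_measurable Y1 Y2 (f : Y1 -> Y2) : continuous f ->
  measurable_fun [set: borel Y1] (f : borel Y1 -> borel Y2).
Proof.
move=> cf; apply: measurable_borelP => U oU; apply: measurable_open.
by apply: open_comp => // x _; exact: cf.
Qed.

Lemma measurable_norm d (S : measurableType d) Y (f : S -> Y) :
  measurable_fun [set: S] (f : S -> borel Y) ->
  measurable_fun [set: S] (fun w => `|f w|).
Proof.
move=> mf mD.
apply: (measurability _ (RGenOInfty.measurableE R)) => //.
move=> _ [_ [x ->] <-].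
apply: (mf mD ((fun y : Y => `|y|) @^-1` `]x, +oo[)); apply: measurable_open.
by apply: open_comp; [move=> y _; exact: norm_continuous|rewrite set_itvE; exact: open_gt].
Qed.

Lemma measurable_sqr_norm d (S : measurableType d) Y (f : S -> Y) :
  measurable_fun [set: S] (f : S -> borel Y) ->
  measurable_fun [set: S] (fun w => (`|f w| ^+ 2)%:E : \bar R).
Proof.
move=> mf; apply/measurable_EFinP; apply: measurable_funX.
exact: measurable_norm.
Qed.

Lemma separable_seq Y : separable Y ->
  exists y : nat -> Y, forall x (e : R), 0 < e -> exists n, `|x - y n| < e.
Proof.
move=> [D cD dD].
have ex x (e : R) : 0 < e -> exists2 z, D z & `|x - z| < e.
  move=> e0; have [|z [zb Dz]] := dD (ball x e) _ (ball_open x e).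
    by exists x; exact: ballxx.
  by exists z => //; move: zb; rewrite -ball_normE.
have /set0P D0 : D !=set0 by have [z Dz _] := ex 0 1 ltr01; exists z.
have /(pfcard_geP) [D00|[f]] := cD; first by rewrite D00 eqxx in D0.
exists f => x e e0; have [z Dz xz] := ex x e e0.
by have [n _ fn] := @surj _ _ _ _ f _ Dz; exists n; rewrite fn.
Qed.

Lemma seq_separable Y (y : nat -> Y) :
  (forall x (e : R), 0 < e -> exists n, `|x - y n| < e) -> separable Y.
Proof.
move=> yd; exists (range y).
  exact: sub_countable (card_image_le y setT) (countableP _).
move=> O [x Ox] oO.
have /nbhs_ballP[e /= e0 eO] : nbhs x O by exact: open_nbhs_nbhs.
have [n xn] := yd x e e0; exists (y n); split; last by exists n.
by apply: eO; rewrite -ball_normE.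
Qed.

Lemma separable_prod Y1 Y2 : separable Y1 -> separable Y2 ->
  separable (Y1 * Y2)%type.
Proof.
move=> /separable_seq[y1 y1d] /separable_seq[y2 y2d].
pose y n := if unpickle n is Some (i, j) then (y1 i, y2 j) else (y1 0, y2 0).
apply: (@seq_separable _ y) => -[a b] e e0.
have [i ai] := y1d a e e0; have [j bj] := y2d b e e0.
exists (pickle (i, j)); rewrite /y pickleK prod_normE/=.
by rewrite gt_max ai.
Qed.

(* One separable factor is enough: an open set of the product is the union of
   the rectangles [B * V] with [B] a ball of a countable base and [V] the
   largest open set such that the rectangle is included in it. *)
Lemma measurable_borel_pair d (S : measurableType d) Y1 Y2
    (f : S -> Y1) (g : S -> Y2) : separable Y1 ->
  measurable_fun [set: S] (f : S -> borel Y1) ->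
  measurable_fun [set: S] (g : S -> borel Y2) ->
  measurable_fun [set: S] (fun x => (f x, g x) : borel (Y1 * Y2)%type).
Proof.
move=> /separable_seq[y yd] mf mg; apply: measurable_borelP => U oU.
pose B i k : set Y1 := ball (y i) k.+1%:R^-1.
pose V i k : set Y2 :=
  \bigcup_(W in [set W : set Y2 | open W /\ B i k `*` W `<=` U]) W.
have -> : (fun x => (f x, g x)) @^-1` U =
    \bigcup_i \bigcup_k (f @^-1` B i k `&` g @^-1` V i k).
  apply/seteqP; split=> [w /= Uw|w [i _ [k _ [Bf [W [oW WU] Wg]]]]]; last first.
    by apply: WU; split.
  have /nbhs_ballP[e /= e0 eU] : nbhs (f w, g w) U by exact: open_nbhs_nbhs.
  have [k ke] : exists k, k.+1%:R^-1 + k.+1%:R^-1 < e.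
    have [k _ /(_ _ (leqnn _)) ke] := near_infty_natSinv_lt (PosNum (divr_gt0 e0 (ltr0Sn R 1))).
    by exists k; rewrite [e]splitr ltrD.
  have [i fi] := yd (f w) k.+1%:R^-1 ltac:(by rewrite invr_gt0).
  exists i => //; exists k => //; split; first by rewrite /B/= -ball_normE/= distrC.
  exists (ball (g w) e) => /=; last exact: ballxx.
  split; first exact: ball_open.
  move=> [a b] [/= Ba bb]; apply: eU; split=> //=.
  rewrite -ball_normE/= (le_lt_trans (ler_distD (y i) _ _))//.
  by rewrite (le_lt_trans _ ke)// ltW// ltrD//; move: Ba; rewrite /B -ball_normE.
apply: bigcupT_measurable => i; apply: bigcupT_measurable => k.
apply: measurableI; rewrite -[X in measurable X]setTI.
  by apply: mf => //; apply: measurable_open; exact: ball_open.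
apply: mg => //; apply: measurable_open; apply: bigcup_open => W [].
by [].
Qed.

Lemma measurable_borelB d (S : measurableType d) Y (f g : S -> Y) :
  separable Y ->
  measurable_fun [set: S] (f : S -> borel Y) ->
  measurable_fun [set: S] (g : S -> borel Y) ->
  measurable_fun [set: S] (fun x => f x - g x : borel Y).
Proof.
move=> sY mf mg.
have c : continuous (fun z : Y * Y => z.1 - z.2).
  by move=> z; apply: cvgB; [exact: cvg_fst|exact: cvg_snd].
exact: measurableT_comp (continuous_borel_measurable c)
  (measurable_borel_pair sY mf mg).
Qed.

Lemma measurable_borelD d (S : measurableType d) Y (f g : S -> Y) :
  separable Y ->
  measurable_fun [set: S] (f : S -> borel Y) ->
  measurable_fun [set: S] (g : S -> borel Y) ->
  measurable_fun [set: S] (fun x => f x + g x : borel Y).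
Proof.
move=> sY mf mg.
have c : continuous (fun z : Y * Y => z.1 + z.2).
  by move=> z; apply: cvgD; [exact: cvg_fst|exact: cvg_snd].
exact: measurableT_comp (continuous_borel_measurable c)
  (measurable_borel_pair sY mf mg).
Qed.

Lemma measurable_borelZ d (S : measurableType d) Y (k : R) (f : S -> Y) :
  measurable_fun [set: S] (f : S -> borel Y) ->
  measurable_fun [set: S] (fun x => k *: f x : borel Y).
Proof.
move=> mf; apply: measurableT_comp mf.
by apply: continuous_borel_measurable => x; apply: cvgZr; exact: cvg_id.
Qed.

End borel_measurability.
Lemma nonexpansive_continuous {R : realType} (Y1 Y2 : normedModType R)
    (f : Y1 -> Y2) :
  (forall x y, `|f x - f y| <= `|x - y|) -> continuous f.
Proof.
move=> fK x; apply/cvgrPdist_lt => e e0; apply/nbhs_ballP; exists e => // y.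
by rewrite -ball_normE/=; exact: le_lt_trans.
Qed.

(** * The space of continuous paths: evaluation, uniform continuity, separability *)

Section paths.
Context {R : realType} (T : R) (X : normedModType R).
Implicit Types f g : cpath T X.

Lemma valL_cpath f t : valL f (set_val t) = f t.
Proof. by rewrite -[in RHS](valLK point f). Qed.

Lemma set_val_itv (t : set_type `[0, T]%classic) : 0 <= set_val t <= T.
Proof. by have := set_valP t; rewrite /= in_itv. Qed.

Lemma cpath_continuous f t (e : R) : 0 < e ->
  exists2 r : R, 0 < r &
    forall u, `|set_val u - set_val t| < r -> `|f u - f t| < e.
Proof.
move=> e0; have cf : {for t, continuous f} := cts_fun t.
move/cvgrPdist_lt : cf => /(_ _ e0) /nbhs_ballP[r r0 fr]; exists r => // u ut.
rewrite distrC; apply: fr.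
by rewrite -initial_ballE /= -ball_normE/= distrC.
Qed.

Lemma cpath_unif_continuous f (e : R) : 0 < e ->
  exists n, forall t u,
    `|set_val u - set_val t| < n.+1%:R^-1 -> `|f u - f t| < e.
Proof.
move=> e0.
(* Compactness is that of the segment in [R], while paths live on a subtype; [Q] is therefore
   centred at a real number [x]. *)
pose Q (n : nat) (x : R) := forall t u, `|set_val t - x| < n.+1%:R^-1 ->
  `|set_val u - x| < n.+1%:R^-1 -> `|f u - f t| < e.
have /compact_near_coveringP/(_ nat \oo Q) := @segment_compact R 0 T.
case=> [x x0T|n _ /(_ _ (leqnn _)) nQ]; last first.
  exists n => t u tu; apply: (nQ (set_val t)) => //.
    by have := set_val_itv t; rewrite /= in_itv.
  by rewrite subrr normr0 invr_gt0.
pose x' : set_type `[0, T]%classic := SigSub (mem_set x0T).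
have [r r0 fr] := cpath_continuous f x' (divr_gt0 e0 (ltr0Sn R 1)).
have [k _ kr] := near_infty_natSinv_lt (PosNum (divr_gt0 r0 (ltr0Sn R 1))).
exists (ball x (r / 2), [set n | (k <= n)%N]).
  split; last by exists k.
  by apply/nbhs_ballP; exists (r / 2) => //=; rewrite divr_gt0.
move=> [y n] [/= xy kn] t u ty uy.
have close (v : set_type `[0, T]%classic) : `|set_val v - y| < n.+1%:R^-1 ->
    `|f v - f x'| < e / 2.
  move=> vy; apply: fr; rewrite (le_lt_trans (ler_distD y _ _))// [r]splitr.
  rewrite ltrD ?(lt_trans vy)//; first exact: kr.
  by move: xy; rewrite -ball_normE/= distrC.
rewrite (le_lt_trans (ler_distD (f x') _ _))// [e]splitr ltrD//; first exact: close.
by rewrite distrC; exact: close.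
Qed.

Lemma cpath_norm_ub f t : `|f t| <= `|f|.
Proof.
rewrite /Num.norm/= /cpath_norm; apply: ub_le_sup; last by exists t.
have cf : {within `[0, T]%classic, continuous (valL f)}.
  by apply/subspace_valL_continuousP; exact: cts_fun.
have /compact_bounded[M [_ fM]] :=
  continuous_compact cf (@segment_compact R 0 T).
exists (M + 1) => _ [u _ <-]; apply: fM; first by rewrite ltrDl.
by exists (set_val u); [exact: set_valP|rewrite valL_cpath].
Qed.

Lemma cpath_norm_le f (c : R) : 0 <= c -> (forall t, `|f t| <= c) -> `|f| <= c.
Proof.
move=> c0 fc; rewrite /Num.norm/= /cpath_norm.
have [->|/set0P ne] := eqVneq (range (fun t => `|f t|)) set0.
  by rewrite sup0.
by apply: ge_sup => // _ [t _ <-].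
Qed.

Lemma continuous_cpath_eval t : continuous (fun f => f t).
Proof.
by apply: nonexpansive_continuous => f g; exact: (cpath_norm_ub (f - g) t).
Qed.

(* A path is localized up to [2 / k.+1] by the indices of points of the dense
   sequence close to its values on the intervals of a fine subdivision. *)
Lemma separable_cpath : separable X -> separable (cpath T X).
Proof.
move=> /separable_seq[y yd].
pose idx n (t : R) : nat := Num.truncn (t * n.+1%:R).
pose cell (a : nat * nat * seq nat) : set (cpath T X) := [set f | forall t,
  `|f t - y (nth 0%N a.2 (idx a.1.2 (set_val t)))| < a.1.1.+1%:R^-1].
(* The cells are indexed by a countable type, and one member of each nonempty cell gives the dense
   sequence; empty cells get the path 0. *)
have /choice[rep repP] a : exists g, cell a !=set0 -> cell a g.
  by have [[g ag]|na] := pselect (cell a !=set0); [exists g|exists 0].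
pose z n := if unpickle n is Some a then rep a else 0.
apply: (@seq_separable _ _ z) => f e e0.
have [k _ /(_ _ (leqnn _)) ke] :=
  near_infty_natSinv_lt (PosNum (divr_gt0 e0 (ltr0Sn R 1))).
have k0 : 0 < k.+1%:R^-1 :> R by rewrite invr_gt0.
have [n fn] := cpath_unif_continuous f (divr_gt0 k0 (ltr0Sn R 1)).
have /choice[i iP] j : exists i, forall t, idx n (set_val t) = j ->
    `|f t - y i| < k.+1%:R^-1.
  have [[t0 t0j]|nt] := pselect (exists t : set_type `[0, T]%classic,
      idx n (set_val t) = j); last by exists 0 => t tj; case: nt; exists t.
  have [i fi] := yd (f t0) _ (divr_gt0 k0 (ltr0Sn R 1)).
  exists i => t tj; rewrite (le_lt_trans (ler_distD (f t0) _ _))//.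
  rewrite [ltRHS]splitr ltrD//; apply: fn.
  have n0 : 0 < n.+1%:R :> R by [].
  have bnd (u : set_type `[0, T]%classic) : idx n (set_val u) = j ->
      j%:R <= set_val u * n.+1%:R < j.+1%:R.
    move=> <-; apply: truncn_itv.
    by rewrite mulr_ge0//; have /andP[] := set_val_itv u.
  have := bnd _ tj; have := bnd _ t0j; rewrite -[j.+1%:R]natr1 => /andP[a b] /andP[c e'].
  rewrite -[ltRHS]mul1r ltr_pdivlMr// -[X in _ * X](gtr0_norm n0) -normrM.
  by rewrite mulrBl ltr_norml; apply/andP; split; lra.
(* The successor is needed because the index of the endpoint [T] itself is attained. *)
pose a : nat * nat * seq nat := (k, n, mkseq i (idx n T).+1).
have af : cell a f.
  move=> t /=; rewrite nth_mkseq; first exact: iP.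
  rewrite ltnS le_truncn// ler_wpM2r//.
  by have /andP[] := set_val_itv t.
have arep := repP _ (ex_intro _ _ af).
exists (pickle a); rewrite /z pickleK.
apply: (@le_lt_trans _ _ (2 * k.+1%:R^-1)).
  apply: cpath_norm_le => [|t]; first by rewrite mulr_ge0// ltW.
  have /ltW ft := af t; have /ltW rt := arep t.
  rewrite (le_trans (ler_distD (y (nth 0%N a.2 (idx a.1.2 (set_val t)))) _ _))//.
  by rewrite mulr_natl mulr2n lerD// distrC.
by rewrite mulrC -ltr_pdivlMr.
Qed.

End paths.

(** * Realization of laws on a nonatomic probability space *)

Section realization.
Context {R : realType} (d : measure_display) (Omega : measurableType d).
Variable P : probability Omega R.
Hypothesis P_nonatomic : nonatomic P.

(** An increasing sequence of subsets whose masses are the partial sums of [q] is built by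
    intermediate values of [P]; its successive differences are the classes, up to a null
    remainder. *)
Lemma nonatomic_partition (A : set Omega) (q : nat -> R) : measurable A ->
  (forall i, 0 <= q i) -> (\sum_(i <oo) (q i)%:E = P A)%E ->
  exists K : Omega -> nat, forall i,
    measurable (A `&` K @^-1` [set i]) /\ P (A `&` K @^-1` [set i]) = (q i)%:E.
Proof.
move=> mA q0 qA.
pose s n := \sum_(i < n) q i.
have sA n : s n <= fine (P A).
  rewrite -lee_fin -fine_probE// -qA /s -sumEFin -(big_mkord xpredT (fun i => (q i)%:E)).
  by apply: nneseries_lim_ge => k _ _; rewrite lee_fin.
have s0 n : 0 <= s n by apply: sumr_ge0.
have /choice[step stepP] (nU : nat * set Omega) : exists W,
    [/\ measurable nU.2, nU.2 `<=` A & fine (P nU.2) = s nU.1] ->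
    [/\ measurable W, W `<=` A, fine (P W) = s nU.1.+1 & nU.2 `<=` W].
  case: nU => n U /=.
  have [[mU UA Us]|nU] := pselect [/\ measurable U, U `<=` A & fine (P U) = s n];
    last by exists set0.
  have mAU := measurableD mA mU.
  have [|C [mC CAU Cq]] := nonatomic_subset P_nonatomic (c := q n) mAU.
    by rewrite q0 fine_probD// Us lerBrDl; have := sA n.+1;
      rewrite {1}/s big_ord_recr.
  exists (U `|` C); split=> //.
  - exact: measurableU.
  - by move=> x [/UA//|/CAU[]].
  - rewrite fine_probU//; first by rewrite Us Cq /s big_ord_recr.
    by rewrite setIC -subset0 => x [/CAU[]].
pose U := fix U n := if n is n'.+1 then step (n', U n') else set0.
have UP n : [/\ measurable (U n), U n `<=` A & fine (P (U n)) = s n].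
  elim: n => [|n [mU UA Us]].
    by split=> //=; rewrite measure0 /s big_ord0.
  by have [] := stepP (n, U n) (And3 mU UA Us).
have US n : U n `<=` U n.+1.
  by have [mU UA Us] := UP n; have [] := stepP (n, U n) (And3 mU UA Us).
have Umono m n : (m <= n)%N -> U m `<=` U n.
  by move=> /subnK <-; elim: (n - m)%N => [//|k IH]; exact: subset_trans IH (US _).
have mU n : measurable (U n) by have [] := UP n.
pose B n := U n.+1 `\` U n.
have mB n : measurable (B n) by apply: measurableD.
have BA n : B n `<=` A by move=> x [Ux _]; have [_ UA _] := UP n.+1; exact: UA.
have PB n : P (B n) = (q n)%:E.
  rewrite fine_probE// /B fine_probD//.
  have [_ _ ->] := UP n; have [_ _ ->] := UP n.+1.
  by rewrite /s big_ord_recr/= addrAC subrr add0r.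
have trB : trivIset setT B.
  apply: ltn_trivIset => m n mn; rewrite -subset0 => x [[U1 _] [_ nU]].
  by apply: nU; exact: (Umono n.+1 m mn x U1).
have mUB : measurable (\bigcup_n B n) by apply: bigcupT_measurable.
have PUB : P (\bigcup_n B n) = P A.
  rewrite measure_semi_bigcup//= -qA; apply: eq_eseriesr => n _.
  exact: PB.
have UBA : \bigcup_n B n `<=` A by apply: bigcup_sub.
have rest0 : P (A `\` \bigcup_n B n) = 0%E.
  by rewrite fine_probE ?fine_probD ?PUB ?subrr//; exact: measurableD.
(* The default 0 sends the null remainder of [A] to class 0, which is why that class is treated
   apart. *)
pose K w := xget 0%N [set n | B n w].
have KB n w : B n w -> K w = n.
  move=> Bnw; apply: xget_unique => // m Bmw.
  by apply: (trB m n) => //; exists w.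
have Kn n : B n `<=` A `&` K @^-1` [set n].
  by move=> w Bw; split; [exact: BA Bw|exact: KB Bw].
have Krest n : (A `&` K @^-1` [set n.+1]) `<=` B n.+1.
  move=> w [_ /= Kw]; have [[m Bmw]|nB] := pselect (exists m, B m w).
    by rewrite (KB _ _ Bmw) in Kw; rewrite -Kw.
  by move: Kw; rewrite /K xgetPN// => m Bm; apply: nB; exists m.
have K0 : A `&` K @^-1` [set 0%N] = B 0%N `|` (A `\` \bigcup_n B n).
  apply/seteqP; split=> [w [Aw /= Kw]|w [/Kn//|[Aw nB]]].
    have [[m _ Bmw]|nB] := pselect ((\bigcup_n B n) w); last by right.
    by left; rewrite -Kw (KB _ _ Bmw).
  by split=> //=; rewrite /K xgetPN// => m Bm; apply: nB; exists m.
exists K => -[|n].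
  have mrest := measurableD mA mUB.
  rewrite K0; split; first exact: measurableU.
  rewrite -[RHS]adde0 -PB -rest0; apply: measureU => //.
  by rewrite -subset0 => w [Bw [_]]; apply; exists 0%N.
have -> : A `&` K @^-1` [set n.+1] = B n.+1.
  by apply/seteqP; split; [exact: Krest|exact: Kn].
by split.
Qed.

Section same_law.
Context (d' : measure_display) (Y : measurableType d') (Q : probability Y R).

(** Lists hold joint laws of any finite number of discrete variables in one countable type, so one
    more variable can be added without changing the type. *)
Definition same_law (J : Omega -> seq nat) (I : Y -> seq nat) :=
  forall s, [/\ measurable (J @^-1` [set s]), measurable (I @^-1` [set s]) &
    P (J @^-1` [set s]) = Q (I @^-1` [set s])].

Lemma preimage_countE (C : countType) (T : Type) (J : T -> C) (E : set C) :
  J @^-1` E = \bigcup_(s in E) J @^-1` [set s].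
Proof. by apply/seteqP; split=> [w Ew|w [s Es /= ->//]]; exists (J w). Qed.

Lemma same_lawP J I E : same_law J I ->
  [/\ measurable (J @^-1` E), measurable (I @^-1` E) &
    P (J @^-1` E) = Q (I @^-1` E)].
Proof.
move=> JI; rewrite (preimage_countE J) (preimage_countE I).
(* Each [c n] is empty or a singleton; enumerating the atoms by their codes turns the union over [E]
   into a sequence, ready for countable additivity. *)
pose c n : set (seq nat) := [set s | E s /\ pickle s = n].
have cE (T : Type) (H : T -> seq nat) :
    \bigcup_(s in E) H @^-1` [set s] = \bigcup_n H @^-1` (c n).
  apply/seteqP; split=> [w [s Es /= Hs]|w [n _ [Es _]]]; last by exists (H w).
  by exists (pickle s) => //; split; rewrite /= Hs.
have tr (T : Type) (H : T -> seq nat) : trivIset setT (fun n => H @^-1` (c n)).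
  by apply/trivIsetP => m n _ _ mn; rewrite -subset0 => w [[_ /= Hm] [_ /= Hn]];
    move: mn; rewrite -Hm -Hn eqxx.
have c1 n : c n = set0 \/ exists s, c n = [set s].
  have [[s [Es sn]]|nc] := pselect (exists s, c n s); last first.
    by left; rewrite -subset0 => s cs; apply: nc; exists s.
  right; exists s; apply/seteqP; split=> [t [Et tn]|_ ->//] /=.
  by apply: (pcan_inj pickleK); rewrite tn.
have JIc n : [/\ measurable (J @^-1` c n), measurable (I @^-1` c n) &
    P (J @^-1` c n) = Q (I @^-1` c n)].
  have [->|[s ->]] := c1 n; last exact: JI.
  by rewrite !preimage_set0 !measure0.
have mJ n := let: And3 h _ _ := JIc n in h.
have mI n := let: And3 _ h _ := JIc n in h.
rewrite !cE; split; [exact: bigcupT_measurable|exact: bigcupT_measurable|].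
rewrite !measure_semi_bigcup//; do ?exact: bigcupT_measurable; apply: eq_eseriesr => n _.
by have [] := JIc n.
Qed.

(** Each atom of [J] is partitioned with the masses of the joint law of [I] and [k]; the new
    variable depends on the atom it starts from. *)
Lemma same_law_extend J I (k : Y -> nat) : same_law J I ->
  (forall i, measurable (k @^-1` [set i])) ->
  exists K : Omega -> nat,
    same_law (fun w => K w :: J w) (fun y => k y :: I y).
Proof.
move=> JI mk.
have mIk s i : measurable (I @^-1` [set s] `&` k @^-1` [set i]).
  by apply: measurableI => //; have [] := JI s.
have /choice[K KP] s : exists K : Omega -> nat, forall i,
    measurable (J @^-1` [set s] `&` K @^-1` [set i]) /\
    P (J @^-1` [set s] `&` K @^-1` [set i]) =
    Q (I @^-1` [set s] `&` k @^-1` [set i]).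
  have [mJ mI PQ] := JI s.
  have [||K KP] := @nonatomic_partition (J @^-1` [set s])
    (fun i => fine (Q (I @^-1` [set s] `&` k @^-1` [set i]))) mJ.
  - by move=> i; exact: fine_prob_ge0.
  - rewrite PQ; under eq_eseriesr do rewrite -fine_probE//.
    rewrite -measure_semi_bigcup//; last 2 first.
      apply/trivIsetP => i j _ _ ij; rewrite -subset0 => y [[_ /= ki] [_ /= kj]].
      by move: ij; rewrite -ki -kj eqxx.
      exact: bigcupT_measurable.
    congr (Q _); apply/seteqP; split=> [y [i _ []//]|y Iy].
    by exists (k y).
  - by exists K => i; have [? ->] := KP i; rewrite -fine_probE.
exists (fun w => K (J w) w) => -[|i s].
  have -> : (fun w => K (J w) w :: J w) @^-1` [set [::]] = set0.
    by rewrite -subset0 => w.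
  have -> : (fun y => k y :: I y) @^-1` [set [::]] = set0 by rewrite -subset0.
  by rewrite !measure0.
have -> : (fun w => K (J w) w :: J w) @^-1` [set i :: s] =
    J @^-1` [set s] `&` K s @^-1` [set i].
  by apply/seteqP; split=> w /= => [[<- <-]//|[-> ->]].
have -> : (fun y => k y :: I y) @^-1` [set i :: s] =
    I @^-1` [set s] `&` k @^-1` [set i].
  by apply/seteqP; split=> w /= => [[<- <-]//|[-> ->]].
by have [mK PK] := KP s i; split.
Qed.

(** Dependent choice along histories. They are listed newest first, so that one more label is a cons
    and [same_law_extend] applies directly. *)
Lemma same_law_exists (k : nat -> Y -> nat) :
  (forall n i, measurable (k n @^-1` [set i])) ->
  exists K : nat -> Omega -> nat, forall n,
    same_law (fun w => [seq K i w | i <- rev (iota 0 n)])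
      (fun y => [seq k i y | i <- rev (iota 0 n)]).
Proof.
move=> mk.
pose I n y := [seq k i y | i <- rev (iota 0 n)].
have IS n y : I n.+1 y = k n y :: I n y.
  by rewrite /I -addn1 iotaD rev_cat.
have /choice[step stepP] (nJ : nat * (Omega -> seq nat)) :
    exists K : Omega -> nat, same_law nJ.2 (I nJ.1) ->
      same_law (fun w => K w :: nJ.2 w) (I nJ.1.+1).
  case: nJ => n J /=; have [JI|nJI] := pselect (same_law J (I n)); last first.
    by exists (fun=> 0%N).
  have [K KP] := same_law_extend JI (mk n); exists K => _.
  by rewrite (_ : I n.+1 = fun y => k n y :: I n y)//; apply/funext => y; exact: IS.
pose J := fix J n := if n is m.+1 then fun w => step (m, J m) w :: J m w
  else fun=> [::].
have JP n : same_law (J n) (I n).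
  elim: n => [s|n IHn]; last exact: (stepP (n, J n)).
  have [->|s0] := eqVneq s [::].
    have -> : J 0%N @^-1` [set [::]] = setT by apply/seteqP; split.
    have -> : I 0%N @^-1` [set [::]] = setT by apply/seteqP; split.
    by rewrite !probability_setT.
  have -> : J 0%N @^-1` [set s] = set0.
    by rewrite -subset0 => w /= ws; rewrite -ws in s0.
  have -> : I 0%N @^-1` [set s] = set0.
    by rewrite -subset0 => w /= ws; rewrite -ws in s0.
  by rewrite !measure0.
exists (fun n => step (n, J n)) => n.
suff -> : (fun w => [seq step (i, J i) w | i <- rev (iota 0 n)]) = J n by exact: JP.
apply/funext => w; elim: n => [//|n IHn].
by rewrite -{1}addn1 iotaD rev_cat/= IHn.
Qed.

End same_law.
End realization.

(** * Completeness of products and geometric sequences *)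

(** Makes [X * X] a complete normed space, so that the realization theorem applies to couplings. *)
Lemma prod_cauchy_cvg {R : realType} (X Y : completeNormedModType R)
    (F : set_system ((X * Y)%type : normedModType R)) :
  ProperFilter F -> cauchy F -> cvg F.
Proof.
move=> FF Fc.
have /cauchyP Fex := Fc.
have cX : cvg (fst @ F).
  apply: cauchy_cvg; apply: cauchy_exP => e e0.
  have [z Fz] := Fex _ e0; exists z.1.
  apply: (@filterS _ F _ (ball z e)) Fz => w;
    by rewrite -!ball_normE/= prod_normE/= gt_max => /andP[].
have cY : cvg (snd @ F).
  apply: cauchy_cvg; apply: cauchy_exP => e e0.
  have [z Fz] := Fex _ e0; exists z.2.
  apply: (@filterS _ F _ (ball z e)) Fz => w;
    by rewrite -!ball_normE/= prod_normE/= gt_max => /andP[].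
apply/cvg_ex; exists (lim (fst @ F), lim (snd @ F)).
apply/fcvgrPdist_lt => e e0.
have /fcvgrPdist_lt/(_ e e0) FX := cX; have /fcvgrPdist_lt/(_ e e0) FY := cY.
have : F ([set w | `|lim (fst @ F) - w.1| < e] `&`
    [set w | `|lim (snd @ F) - w.2| < e]) by apply: filterI.
by apply: filterS => w [/= wX wY]; rewrite prod_normE/= gt_max wX.
Qed.

HB.instance Definition _ (R : realType) (X Y : completeNormedModType R) :=
  Uniform_isComplete.Build (X * Y)%type (@prod_cauchy_cvg R X Y).

Lemma geometric_cvg {R : realType} (Y : completeNormedModType R)
    (u : nat -> Y) (c : R) :
  (forall n, `|u n.+1 - u n| <= c * 2^-1 ^+ n) ->
  exists l, forall n, `|u n - l| <= 2 * c * 2^-1 ^+ n.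
Proof.
move=> uc.
have h0 : (0 : R) < 2^-1 by rewrite invr_gt0.
have c0 : 0 <= c by have := le_trans (normr_ge0 _) (uc 0%N); rewrite expr0 mulr1.
(* The difference of two geometric tails, rather than the first tail alone, makes the induction
   close. *)
have ucauchy n k : `|u (n + k)%N - u n| <= 2 * c * 2^-1 ^+ n - 2 * c * 2^-1 ^+ (n + k).
  elim: k => [|k IHk]; first by rewrite addn0 !subrr normr0.
  rewrite addnS (le_trans (ler_distD (u (n + k)%N) _ _))//.
  by have := uc (n + k)%N; rewrite exprS; lra.
have ule n k : `|u (n + k)%N - u n| <= 2 * c * 2^-1 ^+ n.
  by rewrite (le_trans (ucauchy n k))// gerBl mulr_ge0 ?mulr_ge0 ?exprn_ge0// ltW.
have cu : cvg (u @ \oo).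
  apply: cauchy_cvg; apply: cauchy_exP => e e0.
  have /cvgrPdist_lt/(_ e e0)[n _ /(_ n (leqnn n)) ne] :
      (fun n => 2 * c * 2^-1 ^+ n) @ \oo --> 0.
    rewrite -[0](mulr0 (2 * c)); apply: cvgMr; apply: cvg_expr.
    by rewrite gtr0_norm// invf_lt1// ltr1n.
  exists (u n); exists n => // m /= nm; rewrite -ball_normE/= distrC.
  rewrite -(subnKC nm) (le_lt_trans (ule _ _))// (le_lt_trans _ ne)//.
  by rewrite sub0r normrN ler_norm.
exists (lim (u @ \oo)) => n; rewrite distrC.
have cun : (fun m => `|u m - u n|) @ \oo --> `|lim (u @ \oo) - u n|.
  by apply: cvg_norm; apply: cvgB cu (cvg_cst _).
rewrite -(cvg_lim _ cun)//; apply: limr_le; first exact: cvgP cun. near=> m.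
have nm : (n <= m)%N by near: m; exists n.
by rewrite -(subnKC nm) ule.
Unshelve. all: by end_near. Qed.

(** * Comparison of Borel probabilities on closed sets *)

Section closed_measures.
Context {R : realType} (Y : normedModType R).

Definition fattening (C : set Y) (e : R) : set Y := \bigcup_(c in C) ball c e.

Lemma open_fattening C e : open (fattening C e).
Proof. by apply: bigcup_open => c _; exact: ball_open. Qed.

Lemma fattening_ball C (e r : R) x y :
  fattening C e x -> `|x - y| <= r -> fattening C (e + r) y.
Proof.
move=> [c Cc]; rewrite -ball_normE/= => cx xy; exists c => //.
rewrite -ball_normE/= (le_lt_trans (ler_distD x _ _))//.
by rewrite ltr_leD.
Qed.

Lemma bigcap_fattening C (r : nat -> R) : closed C ->
  r @ \oo --> 0 -> \bigcap_n fattening C (r n) `<=` C.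
Proof.
move=> cC r0 x xC; have /closure_id -> := cC; move=> B /nbhs_ballP[e /= e0 eB].
move/cvgrPdist_lt : r0 => /(_ e e0)[n _ /(_ n (leqnn n)) rn].
have [c Cc] := xC n I; rewrite -ball_normE/= => cx.
exists c; split=> //; apply: eB; rewrite -ball_normE/= distrC (lt_trans cx)//.
by rewrite (le_lt_trans _ rn)// sub0r normrN ler_norm.
Qed.

(** Continuity from above: the fattenings of a closed set decrease to the set itself. *)
Lemma le_prob_fattening (mu nu : Prob Y) C (r : nat -> R) : closed C ->
  nonincreasing_seq r -> (forall n, 0 < r n) -> r @ \oo --> 0 ->
  (forall n, (mu C <= nu (fattening C (r n)))%E) -> (mu C <= nu C)%E.
Proof.
move=> cC rd rpos r0 muC.
have mF n : measurable (fattening C (r n) : set (borel Y)).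
  by apply: measurable_open; exact: open_fattening.
have capE : \bigcap_n fattening C (r n) = C.
  apply/seteqP; split; first exact: bigcap_fattening.
  by move=> x Cx n _; exists x => //; exact: ballxx.
have mC : measurable (\bigcap_n fattening C (r n) : set (borel Y)).
  exact: bigcapT_measurable.
have nd : nonincreasing_seq (fun n => fattening C (r n)).
  move=> m n mn; apply/subsetPset => x [c Cc cx]; exists c => //.
  by apply: le_ball cx; exact: rd.
have := @nonincreasing_cvg_mu _ _ _ nu (fun n => fattening C (r n)) _ mF mC nd.
rewrite capE => /(_ _)/cvg_lim <- //.
  apply: lime_ge; last exact: nearW.
  apply/cvg_ex; eexists; apply: (@nonincreasing_cvg_mu _ _ _ nu _ _ mF mC nd).
  by rewrite (le_lt_trans (probability_le1 _ (mF 0%N)))// ltry.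
by rewrite (le_lt_trans (probability_le1 _ (mF 0%N)))// ltry.
Qed.

(** Open sets are stable under intersection and generate the Borel sets; complements pass from open
    to closed sets, where [le_prob_fattening] gives inequalities in both directions. *)
Lemma borel_prob_unique (mu nu : Prob Y) :
  (forall C, closed C -> mu C = nu C) ->
  forall A, measurable A -> mu A = nu A.
Proof.
move=> munu A mA.
apply: (@measure_unique _ R (borel Y) (@open Y) (fun=> setT)) => //.
- by move=> U V; exact: openI.
- by move=> _; exact: openT.
- by rewrite bigcup_const.
- move=> U oU; have cU := open_closedC oU; have mU := measurable_closed cU.
  have e1 := probability_setC mu mU; have e2 := probability_setC nu mU.
  by rewrite setCK in e1 e2; rewrite /= in e1 e2 *; rewrite [LHS]e1 [RHS]e2 munu.
- by move=> _; rewrite (le_lt_trans (probability_le1 _ measurableT))// ltry.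
Qed.

End closed_measures.

Section law.
Context {R : realType} (d d' : measure_display).
Context (S : measurableType d) (S' : measurableType d').
Variables (P : probability S R) (f : S -> S').

Definition law (mf : measurable_fun [set: S] f) : probability S' R :=
  distribution P (mfun_Sub (mem_set mf)).

Lemma lawE mf A : law mf A = P (f @^-1` A).
Proof. by []. Qed.

Lemma ge0_integral_law mf (g : S' -> \bar R) : measurable_fun [set: S'] g ->
  (forall y, 0 <= g y)%E ->
  (\int[law mf]_y g y = \int[P]_x g (f x))%E.
Proof. by move=> mg g0; rewrite ge0_integral_distribution. Qed.

End law.

Section realization_theorem.
Context {R : realType} (d : measure_display) (Omega : measurableType d).
Variable P : probability Omega R.
Hypothesis P_nonatomic : nonatomic P.
Context (Y : completeNormedModType R) (Q : Prob Y).

(* [k n] records the first point of a dense sequence at distance less than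
   [2^-n]; reproducing the joint law of all [k n] on [Omega] yields a Cauchy
   sequence of discrete random variables. *)
Theorem nonatomic_realization : separable Y ->
  exists2 Z : Omega -> Y, measurable_fun [set: Omega] (Z : Omega -> borel Y) &
    forall A : set (borel Y), measurable A -> Q A = P (Z @^-1` A).
Proof.
move=> /separable_seq[y yd].
pose e n : R := 2^-1 ^+ n.
have e0 n : 0 < e n by rewrite exprn_gt0// invr_gt0.
have ex n x : exists i, `|x - y i| < e n by exact: yd.
pose k n x := ex_minn (ex n x).
have kP n x : `|x - y (k n x)| < e n by rewrite /k; case: ex_minnP.
(* Taking the first index makes each level set a ball minus the earlier balls. *)
have mk n i : measurable ((k n : borel Y -> nat) @^-1` [set i]).
  have -> : (k n : borel Y -> nat) @^-1` [set i] =
      ball (y i) (e n) `\` \bigcup_(j in [set j | (j < i)%N]) ball (y j) (e n).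
    apply/seteqP; split=> [x /= <-|x []].
      split; first by rewrite -ball_normE/= distrC.
      rewrite /k; case: ex_minnP => m _ mmin [j jm].
      by rewrite -ball_normE/= distrC => /mmin; rewrite leqNgt jm.
    rewrite -ball_normE/= distrC => xi nj.
    rewrite /k; case: ex_minnP => m xm /(_ _ xi); rewrite leq_eqVlt => /orP[/eqP//|mi].
    by exfalso; apply: nj; exists m => //; rewrite /= distrC.
  apply: measurableD; apply: measurable_open; first exact: ball_open.
  by apply: bigcup_open => j _; exact: ball_open.
have [K KP] := @same_law_exists _ _ _ P P_nonatomic _ (borel Y) Q k mk.
have revS n : rev (iota 0 n.+1) = n :: rev (iota 0 n).
  by rewrite -addn1 iotaD rev_cat.
pose z n w := y (K n w).
(* The variables [z n] are discrete, so no measurability of [E] is required. *)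
have zP n (E : set Y) : [/\ measurable (z n @^-1` E),
    measurable ((fun x => y (k n x)) @^-1` E : set (borel Y)) &
    P (z n @^-1` E) = Q ((fun x => y (k n x)) @^-1` E)].
  have := same_lawP [set s | E (y (head 0%N s))] (KP n.+1).
  by rewrite revS.
(* This event depends on two labels only. Its counterpart on [Y] is empty, since both approximations
   are close to the same point, so it has probability zero. *)
pose bad n := [set w | ~ `|z n.+1 w - z n w| <= 2 * e n].
have badP n : measurable (bad n) /\ P (bad n) = 0%E.
  have := same_lawP [set s | ~ `|y (nth 0%N s 0) - y (nth 0%N s 1)| <= 2 * e n]
    (KP n.+2).
  rewrite !revS => -[mb _ Pb]; split; first exact: mb.
  rewrite [LHS]Pb -[RHS](measure0 Q); congr (Q _); rewrite -subset0 => x; apply.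
  rewrite /= (le_trans (ler_distD x _ _))//.
  have := ltW (kP n x); have := ltW (kP n.+1 x); rewrite distrC.
  have eS : e n.+1 = 2^-1 * e n by rewrite /e exprS.
  by have := e0 n; rewrite eS; lra.
pose N := \bigcup_n bad n.
have mN : measurable N by apply: bigcupT_measurable => n; case: (badP n).
have PN : P N = 0%E.
  apply/negligibleP => //; apply: negligible_bigcup => n.
  by have [mb Pb] := badP n; apply/negligibleP.
(* The limit of [z n w] off the null set [N], and 0 on it; the factor 4 is the one of
   [geometric_cvg] for increments at most [2 * e n]. *)
have /choice[Z ZP] w : exists l, (N w -> l = 0) /\
    (~ N w -> forall n, `|z n w - l| <= 4 * e n).
  have [Nw|Nw] := pselect (N w); first by exists 0.
  have [|l lP] := @geometric_cvg _ _ (z ^~ w) 2.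
    by move=> n; apply: contrapT => bw; apply: Nw; exists n.
  exists l; split=> // _ n; rewrite (le_trans (lP n))//.
  by rewrite /e; lra.
have PE A B : measurable A -> measurable B -> A `\` N `<=` B -> (P A <= P B)%E.
  move=> mA mB AB; apply: (@le_trans _ _ (P (B `|` N))).
    apply: le_measure; rewrite ?inE//; first exact: measurableU.
    by move=> w Aw; have [Nw|Nw] := pselect (N w); [right|left; apply: AB].
  by rewrite measureU0.
have mZ : measurable_fun [set: Omega] (Z : Omega -> borel Y).
  apply: measurable_borelP => U oU.
  (* Off [N], the limit lies in the open set [U] exactly when some [z n] lies so deep in [U] that
     the error [4 * e n] cannot leave it. *)
  pose U_ n := [set x : Y | forall l, `|x - l| <= 4 * e n -> U l].
  have -> : Z @^-1` U = (N `&` [set _ | U 0]) `|`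
      (\bigcup_n z n @^-1` U_ n) `\` N.
    apply/seteqP; split=> [w /= Uw|w [[Nw U0]|[[n _ Uz] Nw]]] /=; last 2 first.
    - by rewrite (ZP w).1.
    - by apply: Uz; exact: (ZP w).2.
    have [Nw|Nw] := pselect (N w); first by left; rewrite -(ZP w).1.
    right; split=> //.
    have /nbhs_ballP[r /= r0 rU] : nbhs (Z w) U by exact: open_nbhs_nbhs.
    have : (fun n => 8 * e n) @ \oo --> 0.
      rewrite -[0](mulr0 8); apply: cvgMr; apply: cvg_expr.
      by rewrite gtr0_norm ?invr_gt0// invf_lt1// ltr1n.
    move=> /cvgrPdist_lt/(_ r r0)[n _ /(_ n (leqnn n)) nr].
    exists n => // l zl; apply: rU; rewrite -ball_normE/=.
    rewrite (le_lt_trans (ler_distD (z n w) _ _))// distrC.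
    rewrite sub0r normrN gtr0_norm ?mulr_gt0// in nr.
    by have := (ZP w).2 Nw n; have := zl; lra.
  apply: measurableU.
    have [U0|U0] := pselect (U 0).
      by rewrite (_ : [set _ | _] = setT) ?setIT//; apply/seteqP; split.
    by rewrite (_ : [set _ | _] = set0) ?setI0//; apply/seteqP; split.
  apply: measurableD => //; apply: bigcupT_measurable => n.
  by have [] := zP n (U_ n).
exists Z => // A mA; rewrite -(lawE _ mZ).
have fat_cvg c : (fun n => c * e n) @ \oo --> 0.
  rewrite -[0](mulr0 c); apply: cvgMr; apply: cvg_expr.
  by rewrite gtr0_norm ?invr_gt0// invf_lt1// ltr1n.
have fat_nd c : 0 <= c -> nonincreasing_seq (fun n => c * e n).
  move=> c0 m n mn; rewrite ler_wpM2l// /e ler_wiXn2l// ?invr_ge0// invf_le1//.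
  by rewrite ler1n.
have mfat C c : measurable (fattening C c : set (borel Y)).
  by apply: measurable_open; exact: open_fattening.
(* Passing through [z n] costs [e n] on the side of [Q] and [4 * e n] on the side of [Z], whence the
   radius [5 * e n]. In the other direction [5 * e n] leaves room for the strict inequality in
   balls, and the last passage to [Q] gives [6 * e n]. *)
apply: borel_prob_unique mA => C cC; apply/eqP; rewrite eq_le; apply/andP; split.
  apply: (@le_prob_fattening _ _ _ _ _ (fun n => 5 * e n)) => // [|n|n].
  - exact: fat_nd.
  - by rewrite mulr_gt0.
  have [mz mq zq] := zP n (fattening C (e n)).
  apply: (@le_trans _ _ (Q ((fun x => y (k n x)) @^-1` fattening C (e n)))).
    apply: le_measure; rewrite ?inE//; first exact: measurable_closed.
    by move=> x Cx; exists x => //; rewrite -ball_normE/=; exact: kP.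
  rewrite -zq; apply: (PE _ (Z @^-1` fattening C (5 * e n))) => //.
    by rewrite -[X in measurable X]setTI; exact: mZ.
  move=> w [/= Cz Nw]; have := fattening_ball Cz ((ZP w).2 Nw n).
  by congr (fattening _ _ _); lra.
apply: (@le_prob_fattening _ _ _ _ _ (fun n => 6 * e n)) => // [|n|n].
- exact: fat_nd.
- by rewrite mulr_gt0.
have [mz mq zq] := zP n (fattening C (5 * e n)).
apply: (@le_trans _ _ (P (z n @^-1` fattening C (5 * e n)))).
  apply: (PE (Z @^-1` C)) => //.
    by rewrite -[X in measurable X]setTI; apply: mZ => //; exact: measurable_closed.
  move=> w [/= Cz Nw]; exists (Z w) => //; rewrite -ball_normE/= distrC.
  by have := (ZP w).2 Nw n; have := e0 n; lra.
rewrite zq; apply: le_measure; rewrite ?inE//.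
move=> x /= Cx; have := fattening_ball Cx.
rewrite -[in y _]/(k n x) => /(_ (e n) x); rewrite distrC => /(_ (ltW (kP n x))).
by congr (fattening _ _ _); lra.
Qed.

End realization_theorem.

(** * Dyadic chaining *)

Section dyadic.
Context {R : realType} (T : R) (X : normedModType R).
Hypothesis T_gt0 : 0 < T.
Implicit Types phi : R -> X.

Definition dyadic (k j : nat) : R := T * j%:R / 2 ^+ k.

Definition dyadic_index (k : nat) (t : R) : nat :=
  Num.truncn (t / T * 2 ^+ k).

(** A sum dominates the maximum over the grid and, unlike it, can be integrated term by term;
    likewise for the increments below. *)
Definition dyadic_sqr_sum phi (k : nat) : R :=
  \sum_(j < (2 ^ k).+1) `|phi (dyadic k j)| ^+ 2.

Definition dyadic_sqr_var phi (k : nat) : R :=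
  \sum_(j < 2 ^ k) `|phi (dyadic k j.+1) - phi (dyadic k j)| ^+ 2.

Lemma dyadic_itv k j : (j <= 2 ^ k)%N -> 0 <= dyadic k j <= T.
Proof.
move=> jk; have k0 : 0 < 2 ^+ k :> R by rewrite exprn_gt0.
rewrite /dyadic divr_ge0 ?mulr_ge0 ?(ltW T_gt0) ?(ltW k0)//=.
by rewrite ler_pdivrMr// ler_pM2l// -natrX ler_nat.
Qed.

Lemma dyadicS k j : dyadic k j.+1 - dyadic k j = T / 2 ^+ k.
Proof. by rewrite /dyadic -mulrBl -mulrBr -natrB// subSnn mulr1. Qed.

Lemma dyadic_double k j : dyadic k.+1 j.*2 = dyadic k j.
Proof.
rewrite /dyadic -mul2n natrM exprS invfM.
have k0 : 2 ^+ k != 0 :> R by rewrite expf_neq0.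
by field.
Qed.

Lemma dyadic_index_itv k t : 0 <= t ->
  (dyadic_index k t)%:R <= t / T * 2 ^+ k < (dyadic_index k t).+1%:R.
Proof.
move=> t0; apply: truncn_itv.
by rewrite mulr_ge0 ?exprn_ge0// divr_ge0// ltW.
Qed.

Lemma dyadic_index_le k t : 0 <= t <= T -> (dyadic_index k t <= 2 ^ k)%N.
Proof.
move=> /andP[t0 tT]; have /andP[le_t _] := dyadic_index_itv k t0.
rewrite -(ler_nat R) (le_trans le_t)// natrX ler_piMl ?exprn_ge0//.
by rewrite ler_pdivrMr// mul1r.
Qed.

Lemma dyadic_index_near k t : 0 <= t ->
  `|t - dyadic k (dyadic_index k t)| < T / 2 ^+ k.
Proof.
move=> t0; have /andP[lo hi] := dyadic_index_itv k t0.
have k0 : 0 < 2 ^+ k :> R by rewrite exprn_gt0.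
have tE : t = T * (t / T * 2 ^+ k) / 2 ^+ k.
  by field; rewrite ?gt_eqF.
rewrite [X in `|X - _|]tE /dyadic -mulrBl -mulrBr normrM normfV (gtr0_norm k0).
rewrite ltr_pM2r ?invr_gt0// normrM (gtr0_norm T_gt0) -[ltRHS]mulr1 ltr_pM2l//.
rewrite ger0_norm ?subr_ge0//.
by rewrite ltrBlDl natr1.
Qed.

(** Hence the approximations of [t] at two successive levels coincide or are neighbours in the finer
    grid, and one increment of that grid joins them. *)
Lemma dyadic_indexS k t : 0 <= t ->
  dyadic_index k.+1 t = (dyadic_index k t).*2 \/
  dyadic_index k.+1 t = (dyadic_index k t).*2.+1.
Proof.
move=> t0; have /andP[lo hi] := dyadic_index_itv k t0.
have /andP[lo' hi'] := dyadic_index_itv k.+1 t0.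
set i := dyadic_index k t in lo hi *; set j := dyadic_index k.+1 t in lo' hi' *.
rewrite exprS in lo' hi'.
have ij : (i.*2 < j.+1)%N.
  rewrite -(ltr_nat R) (le_lt_trans _ hi')// -mul2n natrM.
  by rewrite mulrCA ler_pM2l.
have ji : (j < i.+1.*2)%N.
  rewrite -(ltr_nat R) (le_lt_trans lo')// -mul2n natrM.
  by rewrite mulrCA ltr_pM2l.
rewrite doubleS in ji.
have : (j == i.*2) || (j == i.*2.+1) by lia.
by case/orP => /eqP; [left|right].
Qed.

Lemma dyadic_step phi k t : 0 <= t <= T ->
  `|phi (dyadic k.+1 (dyadic_index k.+1 t)) - phi (dyadic k (dyadic_index k t))|
     ^+ 2 <= dyadic_sqr_var phi k.+1.
Proof.
move=> tT; have /andP[t0 _] := tT.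
rewrite -(dyadic_double k (dyadic_index k t)).
have := dyadic_index_le k.+1 tT.
have [->|->] := dyadic_indexS k t0 => jk.
  by rewrite subrr normr0 expr0n/= sumr_ge0// => j _; rewrite exprn_ge0.
rewrite /dyadic_sqr_var (bigD1 (Ordinal jk))//= lerDl.
by apply: sumr_ge0 => j _; rewrite exprn_ge0.
Qed.

Lemma dyadic_start phi k t : 0 <= t <= T ->
  `|phi (dyadic k (dyadic_index k t))| ^+ 2 <= dyadic_sqr_sum phi k.
Proof.
move=> tT; have jk := dyadic_index_le k tT; rewrite -ltnS in jk.
rewrite /dyadic_sqr_sum (bigD1 (Ordinal jk))//= lerDl.
by apply: sumr_ge0 => j _; rewrite exprn_ge0.
Qed.

(* Cauchy-Schwarz with the geometric weights [(3/2)^i] and their inverses. *)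
Lemma sqr_sum_geometric (d : nat -> R) n :
  (\sum_(i < n) d i) ^+ 2 <= 3 * \sum_(i < n) (3 / 2) ^+ i * d i ^+ 2.
Proof.
elim: n d => [|n IHn] d; first by rewrite !big_ord0 expr0n/= mulr0.
rewrite !big_ord_recl/= expr0 mul1r.
have := IHn (fun i => d i.+1).
set u := \sum_(i < n) d i.+1.
rewrite (_ : \sum_(i < n) (3 / 2) ^+ bump 0 i * d (bump 0 i) ^+ 2 =
    (3 / 2) * \sum_(i < n) (3 / 2) ^+ i * d i.+1 ^+ 2); last first.
  by rewrite mulr_sumr; apply: eq_bigr => i _; rewrite /bump add1n exprS mulrA.
set v := \sum_(i < n) _ => uv.
(* This square is twice the gap in [(d 0 + u) ^+ 2 <= 3 * d 0 ^+ 2 + (3 / 2) * u ^+ 2]; the constant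
   3 is the sum of the powers of [2 / 3]. *)
have := sqr_ge0 (2 * d 0%N - u); nra.
Qed.

(** Telescoping from level [m] to level [m + n]. Splitting the start from the increments doubles
    both squares, and 6 is this 2 times the 3 of [sqr_sum_geometric]. *)
Lemma dyadic_chain phi m n t : 0 <= t <= T ->
  `|phi (dyadic (m + n) (dyadic_index (m + n) t))| ^+ 2 <=
  2 * dyadic_sqr_sum phi m +
  6 * \sum_(i < n) (3 / 2) ^+ i * dyadic_sqr_var phi (m + i).+1.
Proof.
move=> tT; pose p k := phi (dyadic k (dyadic_index k t)).
pose d i := `|p (m + i).+1 - p (m + i)%N|.
have pn : `|p (m + n)%N| <= `|p m| + \sum_(i < n) d i.
  elim: n => [|n IHn]; first by rewrite addn0 big_ord0 addr0.
  rewrite big_ord_recr/= addrA addnS.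
  rewrite -[p (m + n).+1](subrK (p (m + n)%N)) addrC (le_trans (ler_normD _ _))//.
  by rewrite lerD.
have ps := dyadic_start phi m tT; rewrite -/(p m) in ps.
have ds : \sum_(i < n) (3 / 2) ^+ i * d i ^+ 2 <=
    \sum_(i < n) (3 / 2) ^+ i * dyadic_sqr_var phi (m + i).+1.
  apply: ler_sum => i _; rewrite ler_wpM2l ?exprn_ge0 ?divr_ge0//.
  exact: dyadic_step.
have := sqr_sum_geometric d n.
have d0 : 0 <= \sum_(i < n) d i by apply: sumr_ge0 => i _; exact: normr_ge0.
rewrite -/(p (m + n)%N).
set u := \sum_(i < n) d i in pn d0 *; set v := \sum_(i < n) _ in ds *.
set v' := \sum_(i < n) _ in ds *; set g := dyadic_sqr_sum _ _ in ps *.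
move=> uv.
have : `|p (m + n)%N| ^+ 2 <= (`|p m| + u) ^+ 2.
  by rewrite ler_sqr ?nnegrE ?addr_ge0.
have := sqr_ge0 (`|p m| - u); nra.
Qed.

End dyadic.

Lemma ge0_integral_sum_le {R : realType} d (S : measurableType d)
    (P : probability S R) n (g : nat -> S -> R) (c : R) :
  (forall j, (j < n)%N -> measurable_fun [set: S] (g j)) ->
  (forall j w, 0 <= g j w) ->
  (forall j, (j < n)%N -> (\int[P]_w (g j w)%:E <= c%:E)%E) ->
  (\int[P]_w (\sum_(j < n) g j w)%:E <= (n%:R * c)%:E)%E.
Proof.
elim: n => [|n IHn] mg g0 gc.
  rewrite mul0r; under eq_integral do rewrite big_ord0.
  by rewrite integral0.
under eq_integral do rewrite big_ord_recr/= EFinD.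
rewrite ge0_integralD//.
- rewrite -natr1 mulrDl mul1r EFinD leeD//; last exact: gc.
  by apply: IHn => // j jn; [apply: mg|apply: gc]; rewrite ltnW// ltnS.
- by move=> w _; rewrite lee_fin sumr_ge0.
- apply/measurable_EFinP; apply: measurable_sum => j.
  by apply: mg; rewrite ltnS ltnW.
- by move=> w _; rewrite lee_fin.
- by apply/measurable_EFinP; exact: mg.
Qed.

(** The dyadic estimates concern functions on [R], so paths enter them through the extension [valL];
    this translates back to the subtype. *)
Lemma valL_itv {R : realType} (T : R) (X : normedModType R) (r : R) :
  0 <= r <= T -> exists2 t : set_type `[0, T]%classic, set_val t = r &
    forall f : cpath T X, valL f r = f t.
Proof.
move=> rT; have rT' : `[0, T]%classic r by rewrite /= in_itv.
exists (SigSub (mem_set rT')) => // f.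
by rewrite -valL_cpath.
Qed.

Section chaining.
Context {R : realType} (T : R) (X : normedModType R).
Hypotheses (T_gt0 : 0 < T) (X_separable : separable X).
Context d (Omega : measurableType d) (P : probability Omega R).

Lemma measurable_valL (h : Omega -> cpath T X) r : 0 <= r <= T ->
  measurable_fun [set: Omega] (h : Omega -> borel (cpath T X)) ->
  measurable_fun [set: Omega] (fun w => valL (h w) r : borel X).
Proof.
move=> rT mh; have [t _ fE] := valL_itv X rT.
have -> : (fun w => valL (h w) r) = (fun f : cpath T X => f t) \o h.
  by apply/funext => w; exact: fE.
have mt : measurable_fun [set: borel (cpath T X)]
    ((fun f : cpath T X => f t) : borel (cpath T X) -> borel X).
  exact: (@continuous_borel_measurable R (cpath T X) X _
    (@continuous_cpath_eval R T X t)).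
exact: measurableT_comp mt mh.
Qed.

(** Every time is a limit of its dyadic approximations, at which [dyadic_chain] applies; continuity
    of the path does the rest. *)
Lemma cpath_sqr_norm_le (f : cpath T X) m (c : R) :
  (forall n, 2 * dyadic_sqr_sum T (valL f) m +
    6 * \sum_(i < n) (3 / 2) ^+ i * dyadic_sqr_var T (valL f) (m + i).+1 <= c) ->
  `|f| ^+ 2 <= c.
Proof.
move=> fc.
have c0 : 0 <= c.
  apply: le_trans (fc 0%N); rewrite big_ord0 mulr0 addr0 mulr_ge0// sumr_ge0//.
rewrite -[c]sqr_sqrtr// ler_sqr ?nnegrE ?sqrtr_ge0//.
apply: cpath_norm_le => [|t]; first exact: sqrtr_ge0.
have tT := set_val_itv t; have /andP[t0 _] := tT.
apply/ler_addgt0Pr => e e0.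
have [r r0 fr] := cpath_continuous f t e0.
have : (fun n => T * 2^-1 ^+ n) @ \oo --> 0.
  rewrite -[0](mulr0 T); apply: cvgMr; apply: cvg_expr.
  by rewrite gtr0_norm ?invr_gt0// invf_lt1// ltr1n.
move=> /cvgrPdist_lt/(_ r r0)[n _ /(_ (m + n)%N (leq_addl _ _)) nr].
rewrite sub0r normrN gtr0_norm ?mulr_gt0 ?exprn_gt0 ?invr_gt0// in nr.
have iT := dyadic_itv T_gt0 (dyadic_index_le T_gt0 (m + n) tT).
have [u ur fE] := valL_itv X iT.
have ut : `|f u - f t| < e.
  apply: fr; rewrite ur distrC (lt_trans (dyadic_index_near T_gt0 _ t0))//.
  by rewrite -exprVn.
have fu : `|f u| <= Num.sqrt c.
  rewrite -ler_sqr ?nnegrE ?sqrtr_ge0// sqr_sqrtr// -fE.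
  exact: le_trans (dyadic_chain T_gt0 (valL f) m n tT) (fc n).
rewrite -[f t](subrK (f u)) addrC (le_trans (ler_normD _ _))// lerD//.
by rewrite distrC ltW.
Qed.

Lemma sum_geometric_le n : \sum_(i < n) (3 / 4) ^+ i <= 4 :> R.
Proof.
suff : \sum_(i < n) (3 / 4) ^+ i + 4 * (3 / 4) ^+ n = 4 :> R.
  have : 0 <= 4 * (3 / 4) ^+ n :> R by rewrite mulr_ge0// exprn_ge0// divr_ge0.
  lra.
elim: n => [|n IHn]; first by rewrite big_ord0 expr0; ring.
rewrite big_ord_recr/= exprS.
by set u := \sum_(i < n) _ in IHn *; set v := _ ^+ n in IHn *; lra.
Qed.

(** The expected squared variation at level [k] is at most [B * T ^+ 2 / 2 ^+ k], so a weight ratio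
    between 1 and 2 is affordable. With [3 / 2] the series has ratio [3 / 4] and sum 4, and the
    weight 6 at level [m + 1] gives [6 / 2 * 4 = 12]. *)
Lemma cpath_chaining (h : Omega -> cpath T X) (A B h0 : R) m :
  measurable_fun [set: Omega] (h : Omega -> borel (cpath T X)) ->
  0 <= A -> 0 <= B -> T / 2 ^+ m <= h0 ->
  (forall r, 0 <= r <= T ->
    (\int[P]_w (`|valL (h w) r| ^+ 2)%:E <= A%:E)%E) ->
  (forall r r', 0 <= r <= T -> 0 <= r' <= T -> 0 <= r' - r <= h0 ->
    (\int[P]_w (`|valL (h w) r' - valL (h w) r| ^+ 2)%:E <=
       (B * (r' - r) ^+ 2)%:E)%E) ->
  (\int[P]_w (`|h w| ^+ 2)%:E <=
     (2 * (2 ^+ m + 1) * A + 12 * B * T ^+ 2 / 2 ^+ m)%:E)%E.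
Proof.
move=> mh A0 B0 mh0 hA hB.
(* The terms of the bound in [dyadic_chain], the grid sum of level [m] first. Their series majorizes
   the squared norm of the path, possibly by [+oo], and is integrated term by term against the
   bounds [c i]. *)
pose f i w : R := if i is i'.+1 then
    6 * ((3 / 2) ^+ i' * dyadic_sqr_var T (valL (h w)) (m + i').+1)
  else 2 * dyadic_sqr_sum T (valL (h w)) m.
pose c i : R := if i is i'.+1 then
    6 * ((3 / 2) ^+ i' * (2 ^+ (m + i').+1 * (B * (T / 2 ^+ (m + i').+1) ^+ 2)))
  else 2 * ((2 ^+ m + 1) * A).
have mphi k j : (j <= 2 ^ k)%N ->
    measurable_fun [set: Omega] (fun w => valL (h w) (dyadic T k j) : borel X).
  by move=> jk; apply: measurable_valL => //; exact: dyadic_itv.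
have msum k : measurable_fun [set: Omega] (fun w => dyadic_sqr_sum T (valL (h w)) k).
  apply: measurable_sum => j; apply: measurable_funX; apply: measurable_norm.
  by apply: mphi; rewrite -ltnS.
have mvar k : measurable_fun [set: Omega] (fun w => dyadic_sqr_var T (valL (h w)) k).
  apply: measurable_sum => j; apply: measurable_funX; apply: measurable_norm.
  by apply: measurable_borelB => //; apply: mphi => //; exact: ltnW.
have sum0 k phi : 0 <= dyadic_sqr_sum T phi k.
  by apply: sumr_ge0 => j _; rewrite exprn_ge0.
have var0 k phi : 0 <= dyadic_sqr_var T phi k.
  by apply: sumr_ge0 => j _; rewrite exprn_ge0.
have mf i : measurable_fun [set: Omega] (f i).
  by case: i => [|i]; rewrite /f; do ?apply: measurable_funM => //.
have f0 i w : 0 <= f i w.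
  by case: i => [|i]; rewrite /f !mulr_ge0// exprn_ge0// divr_ge0.
have fc i : (\int[P]_w (f i w)%:E <= (c i)%:E)%E.
  case: i => [|i]; rewrite /f /c.
    under eq_integral do rewrite EFinM.
    rewrite ge0_integralZl_EFin//; last 2 first.
    - by move=> w _; rewrite lee_fin.
    - exact/measurable_EFinP.
    rewrite [leRHS]EFinM lee_wpmul2l// -natrX natr1.
    apply: (@ge0_integral_sum_le _ _ _ P _
      (fun j w => `|valL (h w) (dyadic T m j)| ^+ 2)) => [j jm|j w|j jm].
    - by apply: measurable_funX; apply: measurable_norm; exact: mphi.
    - by rewrite exprn_ge0.
    - by apply: hA; apply: dyadic_itv.
  under eq_integral do rewrite mulrA EFinM.
  rewrite mulrA ge0_integralZl_EFin//; last 2 first.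
  - by move=> w _; rewrite lee_fin.
  - exact/measurable_EFinP.
  rewrite [leRHS]EFinM lee_wpmul2l//.
  rewrite -[X in (X * _)%:E]natrX.
  apply: (@ge0_integral_sum_le _ _ _ P _
    (fun j w => `|valL (h w) (dyadic T (m + i).+1 j.+1) -
                 valL (h w) (dyadic T (m + i).+1 j)| ^+ 2)) => [j jm|j w|j jm].
  - apply: measurable_funX; apply: measurable_norm.
    by apply: measurable_borelB => //; apply: mphi => //; exact: ltnW.
  - by rewrite exprn_ge0.
  - rewrite -(dyadicS T (m + i).+1 j); apply: hB.
    + by apply: dyadic_itv => //; exact: ltnW.
    + exact: dyadic_itv.
    + rewrite dyadicS divr_ge0 ?exprn_ge0 ?(ltW T_gt0)//=.
      rewrite (le_trans _ mh0)// ler_pM2l// lef_pV2 ?posrE ?exprn_gt0//.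
      by rewrite ler_eXn2l ?ltr1n// -addnS leq_addr.
have csum n : \sum_(i < n) c i <= 2 * (2 ^+ m + 1) * A + 12 * B * T ^+ 2 / 2 ^+ m.
  case: n => [|n].
    by rewrite big_ord0 addr_ge0 ?mulr_ge0 ?addr_ge0 ?invr_ge0 ?exprn_ge0 ?(ltW T_gt0).
  rewrite big_ord_recl/= mulrA lerD2l.
  rewrite (_ : \sum_(i < n) _ =
      3 * B * T ^+ 2 / 2 ^+ m * \sum_(i < n) (3 / 4) ^+ i); last first.
    rewrite mulr_sumr; apply: eq_bigr => i _; rewrite (exprS 2 (m + i)) (exprD 2 m i).
    have m0 : 2 ^+ m != 0 :> R by rewrite expf_neq0.
    have i0 : 2 ^+ i != 0 :> R by rewrite expf_neq0.
    have f4 : 4 ^+ i = 2 ^+ i * 2 ^+ i :> R.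
      by rewrite -exprMn; congr (_ ^+ _); ring.
    by rewrite !expr_div_n f4; field; rewrite m0 i0.
  rewrite (_ : 12 * B * T ^+ 2 / 2 ^+ m = 3 * B * T ^+ 2 / 2 ^+ m * 4); last by ring.
  by rewrite ler_wpM2l ?sum_geometric_le ?mulr_ge0 ?invr_ge0 ?exprn_ge0 ?(ltW T_gt0).
apply: (@le_trans _ _ (\int[P]_w (\sum_(i <oo) (f i w)%:E))%E).
  apply: ge0_le_integral => //.
  - exact: measurable_sqr_norm.
  - by apply: ge0_emeasurable_sum => [i w _ _|i _]; [rewrite lee_fin|exact/measurable_EFinP].
  - move=> w _.
    have part n : (\sum_(0 <= i < n) (f i w)%:E <= \sum_(i <oo) (f i w)%:E)%E.
      by apply: nneseries_lim_ge => i _ _; rewrite lee_fin.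
    case E : (\sum_(i <oo) (f i w)%:E)%E part => [r| |] part; last 2 first.
    + by rewrite leey.
    + by have := part 0%N; rewrite big_nil.
    rewrite lee_fin; apply: (@cpath_sqr_norm_le _ m) => n.
    have := part n.+1; rewrite sumEFin lee_fin big_mkord big_ord_recl/=.
    by apply: le_trans; rewrite lerD2l mulr_sumr.
rewrite integral_nneseries//; last 2 first.
- by move=> i; exact/measurable_EFinP.
- by move=> i w _; rewrite lee_fin.
apply: lime_le.
  by apply: is_cvg_nneseries => i _ _; apply: integral_ge0 => w _; rewrite lee_fin.
apply: nearW => n; apply: (@le_trans _ _ (\sum_(0 <= i < n) (c i)%:E)%E).
  by apply: lee_sum => i _; exact: fc.
by rewrite sumEFin lee_fin big_mkord.
Qed.

End chaining.

(** * Lipschitz functions with bounded Dini derivative *)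

Section dini.
Context {R : realType}.
Let mu := @lebesgue_measure R.

Lemma negligible_open_cover (N : set R) (e : R) : mu.-negligible N -> 0 < e ->
  exists U : set R, [/\ open U, N `<=` U & (mu U <= e%:E)%E].
Proof.
move=> [D [mD D0 ND]] e0.
have [|U [oU DU UD]] := lebesgue_regularity_outer mD _ e0.
  by rewrite [X in (X < _)%E]D0 ltry.
exists U; split=> //; first exact: subset_trans DU.
have mU : measurable U by exact: open_measurable.
have UE : (mu U = mu D + mu (U `\` D))%E.
  rewrite -[in LHS](setDUK DU); apply: measureU => //; last by rewrite setDIK.
  exact: measurableD.
by rewrite UE [X in (X + _)%E]D0 add0e ltW.
Qed.

(* Cover the exceptional set by an open set [U] of small measure and argue by
   connectedness, the slope of [t |-> K * mu (U `&` [0, t])] compensating the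
   growth of [G] near the points of [U]. *)
Lemma dini_lipschitz_le (G : R -> R) (tau K c : R) : 0 <= c -> 0 <= K ->
  (forall s t, 0 <= s <= tau -> 0 <= t <= tau -> G t - G s <= K * `|t - s|) ->
  {ae mu, forall t, 0 < t < tau -> forall e, 0 < e -> exists2 r, 0 < r &
    forall h, 0 < h < r -> t + h <= tau -> G (t + h) - G t <= h * (c + e)} ->
  forall t, 0 <= t <= tau -> G t <= G 0 + c * t.
Proof.
move=> c0 K0 GK [N0 [mN0 N00 N0P]] t1 t1tau.
(* The slope condition holds only at positive times, so 0 is put among the exceptional points that
   [U] covers. *)
pose N := N0 `|` [set 0].
have Nneg : mu.-negligible N.
  apply: negligibleU; first exact/negligibleP.
  by apply/negligibleP => //; exact: lebesgue_measure_set1.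
have NP t : ~ N t -> 0 < t < tau -> forall e, 0 < e -> exists2 r, 0 < r &
    forall h, 0 < h < r -> t + h <= tau -> G (t + h) - G t <= h * (c + e).
  by move=> Nt; apply: contrapT => nP; apply: Nt; left; exact: N0P.
suff main e eta : 0 < e -> 0 < eta -> G t1 <= G 0 + (c + e) * t1 + K * eta.
  apply/ler_addgt0Pr => e e0.
  (* The errors [d * t1] and [K * d] must together stay below [e]. *)
  have d0 : 0 < e / (t1 + K + 1).
    by rewrite divr_gt0// ltr_wpDl// addr_ge0//; case/andP: t1tau.
  have := main _ _ d0 d0; set d := e / _ => Gd.
  have : d * (t1 + K + 1) = e.
    by rewrite divfK// gt_eqF// ltr_wpDl// addr_ge0//; case/andP: t1tau.
  by move: (t1tau) => /andP[t10 _]; nra.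
move=> e0 eta0.
have [U [oU NU Ueta]] := negligible_open_cover Nneg eta0.
have mU : measurable U by exact: open_measurable.
pose I (t : R) : set R := `[0, t]%classic.
pose phi t : R := fine (mu (U `&` I t)).
have mUt (t : R) : measurable (U `&` I t) by apply: measurableI => //; exact: measurable_itv.
have muU t : (mu (U `&` I t) <= eta%:E)%E.
  by apply: le_trans Ueta; apply: le_measure; rewrite ?inE//; exact: mUt.
have muE t : mu (U `&` I t) = (phi t)%:E.
  by rewrite fineK// ge0_fin_numE// (le_lt_trans (muU t))// ltry.
have phi_mono s t : s <= t -> phi s <= phi t.
  move=> st; rewrite -lee_fin -!muE.
  apply: le_measure; rewrite ?inE; do ?exact: mUt.
  by apply: setIS => x; rewrite /I/= !in_itv/= => /andP[-> /le_trans]; exact.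
have phi_slope s t : 0 <= s -> s <= t -> `]s, t] `<=` U -> phi s + (t - s) <= phi t.
  move=> s0 st sU; rewrite -lee_fin EFinD -!muE.
  have -> : (t - s)%:E = mu (`]s, t]%classic : set R).
    rewrite /mu lebesgue_measure_itv/= lte_fin; case: ltgtP st => // -> _.
    by rewrite subrr.
  have mst : measurable (`]s, t]%classic : set R) by exact: measurable_itv.
  have dst : U `&` I s `&` `]s, t]%classic = set0.
    rewrite -subset0 => x [[_]]; rewrite /I/= !in_itv/= => /andP[_ xs] /andP[sx _].
    by have := lt_le_trans sx xs; rewrite ltxx.
  have /= <- := measureU mu (mUt s) mst dst.
  apply: le_measure; rewrite ?inE; [|exact: mUt|].
    by apply: measurableU mst; exact: mUt.
  move=> x [[Ux xs]|xst]; split=> //; last 2 first.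
  - exact: sU.
  - by move: xst; rewrite /I/= !in_itv/= => /andP[sx ->]; rewrite (ltW (le_lt_trans s0 sx)).
  by move: xs; rewrite /I/= !in_itv/= => /andP[-> /le_trans]; exact.
pose good t := G t <= G 0 + (c + e) * t + K * phi t.
suff gt1 : good t1.
  apply: (le_trans gt1); rewrite lerD2l ler_wpM2l// -lee_fin -muE.
  exact: muU.
pose A := [set t | 0 <= t <= tau /\ forall s, 0 <= s <= t -> good s].
have phi_ge0 t : 0 <= phi t by exact: fine_ge0.
have tau0 : 0 <= tau by move: t1tau => /andP[]; exact: le_trans.
have A0 : A 0.
  split; first by rewrite lexx.
  move=> s /andP[s0 s0']; have -> : s = 0 by apply: le_anti; rewrite s0 s0'.
  by rewrite /good mulr0 addr0 lerDl mulr_ge0.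
have Aub : has_ubound A by exists tau => t [/andP[]].
have Asup : has_sup A by split; [exists 0|].
pose m := sup A.
have m0 : 0 <= m by exact: ub_le_sup.
have mtau : m <= tau by apply: ge_sup; [exists 0|move=> t [/andP[]]].
have ce0 : 0 <= c + e by rewrite addr_ge0// ltW.
have below s : 0 <= s < m -> good s.
  move=> /andP[s0 sm]; have [a [_ aP] sa] := sup_gt (ex_intro _ 0 A0) sm.
  by apply: aP; rewrite s0 ltW.
have goodm : good m.
  apply/ler_addgt0Pr => d d0.
  have [->|mneq0] := eqVneq m 0.
    by have [_ /(_ 0)] := A0; rewrite lexx => /(_ isT); rewrite /good; lra.
  have mpos : 0 < m by rewrite lt_neqAle eq_sym mneq0.
  (* Between this [s] and [m] the Lipschitz bound loses at most [d], so goodness passes to the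
     supremum. *)
  pose s := Num.max 0 (m - d / (K + 1)).
  have K1 : 0 < K + 1 by rewrite ltr_wpDl.
  have s0m : 0 <= s < m.
    rewrite le_max lexx/= gt_max mpos/= ltrBlDr ltrDl divr_gt0//.
  have := below _ s0m; move: (s0m) => /andP[s0 sm].
  have stau : 0 <= s <= tau by rewrite s0 (le_trans (ltW sm)).
  have := GK _ _ stau (introT andP (conj m0 mtau)).
  rewrite ger0_norm; last by rewrite subr_ge0 ltW.
  rewrite /good.
  have sd : (m - s) * (K + 1) <= d.
    rewrite -ler_pdivlMr// lerBlDr addrC -lerBlDr /s le_max lexx orbT//.
  have := phi_mono _ _ (ltW sm); have ms : 0 <= m - s by rewrite subr_ge0 ltW.
  move=> p1 p2 p3.
  have : K * phi s <= K * phi m by rewrite ler_wpM2l.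
  have : (c + e) * s <= (c + e) * m by rewrite ler_wpM2l// ltW.
  nra.
have Am : A m.
  split; first by rewrite m0.
  move=> s /andP[s0]; rewrite le_eqVlt => /orP[/eqP->//|sm].
  by apply: below; rewrite s0.
have [mt|tm] := ltP m tau; last first.
  have [_ +] := Am; apply; case/andP: t1tau => -> /=/le_trans; exact.
exfalso.
suff [r r0 rP] : exists2 r, 0 < r & forall h, 0 < h < r -> m + h <= tau -> good (m + h).
  pose h := Num.min (r / 2) (tau - m).
  have h0 : 0 < h by rewrite lt_min divr_gt0//= subr_gt0.
  have : A (m + h).
    split.
      by rewrite addr_ge0 ?(ltW h0)//= -lerBrDl ge_min lexx orbT.
    move=> s /andP[s0 smh]; have [sm|ms] := leP s m.
      by have [_ +] := Am; apply; rewrite s0.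
    rewrite -[s](subrKC m); apply: rP.
      rewrite subr_gt0 ms/= ltrBlDl (le_lt_trans smh)// ltrD2l.
      by rewrite gt_min ltr_pdivrMr// ltr_pMr// ltr1n.
    by rewrite subrKC (le_trans smh)// -lerBrDl ge_min lexx orbT.
  move=> /(ub_le_sup Aub); rewrite -/m leNgt => /negP; apply.
  by rewrite ltrDl.
(* Inside [U] the growth [K * h] of [G] is paid by [phi], which has slope 1 there; outside, [m] is
   not exceptional and the slope condition extends goodness to the right. *)
have [Um|nUm] := pselect (U m).
  have /nbhs_ballP[r /= r0 rU] : nbhs m U by exact: open_nbhs_nbhs.
  exists r => // h /andP[h0 hr] mh.
  have := phi_slope m (m + h) m0; rewrite lerDl => /(_ (ltW h0)).
  have sub : `]m, m + h] `<=` U.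
    move=> x /=; rewrite in_itv/= => /andP[mx xmh]; apply: rU.
    by rewrite -ball_normE/= ltr0_norm ?subr_lt0// opprB ltrBlDl (le_lt_trans xmh)// ltrD2l.
  move=> /(_ sub).
  have mI : 0 <= m <= tau by rewrite m0.
  have mhI : 0 <= m + h <= tau by rewrite mh addr_ge0// ltW.
  have := GK _ _ mI mhI; rewrite (addrC m) addrK gtr0_norm//.
  move: goodm; rewrite /good => g1 g2 g3.
  have : K * (phi m + h) <= K * phi (h + m) by rewrite ler_wpM2l.
  have : 0 <= (c + e) * h by rewrite mulr_ge0// ltW.
  nra.
have Nm : ~ N m by move=> /NU.
have mpos : 0 < m.
  by rewrite lt_neqAle m0 andbT; apply/negP => /eqP m0'; apply: Nm; right.
have [r r0 rP] := NP m Nm (introT andP (conj mpos mt)) _ e0.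
exists r => // h hr mh; have := rP h hr mh.
move: (hr) => /andP[h0 _]; move: goodm; rewrite /good => g1 g2.
have : K * phi m <= K * phi (m + h) by rewrite ler_wpM2l// phi_mono// lerDl ltW.
nra.
Qed.

End dini.

(** * Calculus in L2 *)

Section inner_product.
Context {R : realType} {X : normedModType R} (ip : {dot X for idfun}).
Hypothesis ip_norm : forall x : X, ip x x = `|x| ^+ 2.

Lemma ipC x y : ip x y = ip y x.
Proof. by rewrite hermC expr0 mul1r. Qed.

Lemma ipDr x y z : ip x (y + z) = ip x y + ip x z.
Proof. by rewrite linearDr. Qed.

Lemma ipDl x y z : ip (x + y) z = ip x z + ip y z.
Proof. by rewrite ipC ipDr ipC (ipC z). Qed.

Lemma ipZr k x y : ip x (k *: y) = k * ip x y.
Proof. by rewrite linearZr_LR. Qed.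

Lemma ipBr x y z : ip x (y - z) = ip x y - ip x z.
Proof. by rewrite ipDr -scaleN1r ipZr mulN1r. Qed.

Lemma ipBl x y z : ip (x - y) z = ip x z - ip y z.
Proof. by rewrite ipC ipBr ipC (ipC z). Qed.

Lemma sqr_normD x y : `|x + y| ^+ 2 = `|x| ^+ 2 + 2 * ip x y + `|y| ^+ 2.
Proof. by rewrite -!ip_norm ipDr !ipDl (ipC y x); ring. Qed.

(** Reduces measurability and integrability of inner products to those of squared norms. *)
Lemma ip_polar x y : ip x y = (`|x + y| ^+ 2 - `|x| ^+ 2 - `|y| ^+ 2) / 2.
Proof. by rewrite sqr_normD; field. Qed.

Lemma ip_young (k : R) (x y : X) : 0 < k ->
  2 * ip x y <= k * `|x| ^+ 2 + `|y| ^+ 2 / k.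
Proof.
move=> k0; have := sqr_ge0 `|k *: x - y|.
rewrite sqr_normD normrN normrZ (gtr0_norm k0) -scaleN1r ipZr ipC ipZr ipC exprMn.
move=> H; rewrite -subr_ge0.
have -> : k * `|x| ^+ 2 + `|y| ^+ 2 / k - 2 * ip x y =
    (k ^+ 2 * `|x| ^+ 2 + 2 * (-1 * (k * ip x y)) + `|y| ^+ 2) / k.
  by field; rewrite gt_eqF.
by rewrite divr_ge0// ltW.
Qed.

Lemma sqr_normD_young (k : R) (x y : X) : 0 < k ->
  `|x + y| ^+ 2 <= (1 + k) * `|x| ^+ 2 + (1 + k^-1) * `|y| ^+ 2.
Proof.
by move=> k0; rewrite sqr_normD; have := ip_young x y k0; rewrite mulrC; lra.
Qed.

End inner_product.

Section L2_calculus.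
Context {R : realType} (d : measure_display) (Omega : measurableType d).
Variable P : probability Omega R.
Context (X : normedModType R).
Hypothesis X_separable : separable X.
Implicit Types (f g : Omega -> X) (u v : Omega -> R).

Local Notation intg u := (P.-integrable [set: Omega] (EFin \o u)).

Definition sq f : R := (\int[P]_w (`|f w| ^+ 2))%R.

Lemma integrable_addr u v : intg u -> intg v -> intg (fun w => u w + v w).
Proof. by move=> iu iv; exact: (integrableD _ iu iv). Qed.

Lemma integrable_mulr (k : R) u : intg u -> intg (fun w => k * u w).
Proof. by move=> iu; exact: (integrableZl _ k iu). Qed.

Lemma L2_integrable f : L2 P f -> intg (fun w => `|f w| ^+ 2).
Proof.
move=> [mf foo]; apply/integrableP; split; first exact: measurable_sqr_norm.
by under eq_integral do rewrite /= ger0_norm ?exprn_ge0//.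
Qed.

Lemma sqE f : L2 P f -> (\int[P]_w (`|f w| ^+ 2)%:E)%E = (sq f)%:E.
Proof.
move=> Lf; rewrite fineK//.
exact: (integrable_fin_num measurableT (L2_integrable Lf)).
Qed.

Lemma sq_ge0 f : 0 <= sq f.
Proof. by apply: Rintegral_ge0 => w _; rewrite exprn_ge0. Qed.

Lemma L2Z (k : R) f : L2 P f -> L2 P (fun w => k *: f w).
Proof.
move=> Lf; have [mf foo] := Lf; split; first exact: measurable_borelZ.
under eq_integral do rewrite normrZ exprMn EFinM.
rewrite ge0_integralZl_EFin//.
- by rewrite sqE// ltry.
- exact: measurable_sqr_norm.
Qed.

Lemma L2D f g : L2 P f -> L2 P g -> L2 P (fun w => f w + g w).
Proof.
move=> Lf Lg; have [mf foo] := Lf; have [mg goo] := Lg.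
have mfg := measurable_borelD X_separable mf mg; split=> //.
apply: (@le_lt_trans _ _
    (\int[P]_w ((2 * `|f w| ^+ 2 + 2 * `|g w| ^+ 2)%:E))%E).
  apply: ge0_le_integral => //.
  - exact: measurable_sqr_norm.
  - apply/measurable_EFinP; apply: measurable_funD;
      by apply: measurable_funM => //; apply: measurable_funX; exact: measurable_norm.
  - move=> w _; rewrite lee_fin.
    have := ler_normD (f w) (g w); have := normr_ge0 (f w + g w).
    by have := sqr_ge0 (`|f w| - `|g w|); nra.
have /integrableP[_ +] : intg (fun w => 2 * `|f w| ^+ 2 + 2 * `|g w| ^+ 2).
  by apply: integrable_addr; apply: integrable_mulr; exact: L2_integrable.
by under eq_integral do rewrite /= ger0_norm ?addr_ge0 ?mulr_ge0 ?exprn_ge0//.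
Qed.

Lemma L2B f g : L2 P f -> L2 P g -> L2 P (fun w => f w - g w).
Proof.
move=> Lf Lg; have := L2D Lf (L2Z (-1) Lg).
by under eq_fun do rewrite scaleN1r.
Qed.

Lemma L2distE f g : L2 P f -> L2 P g ->
  L2dist P f g = (Num.sqrt (sq (fun w => f w - g w)))%:E.
Proof.
move=> Lf Lg; rewrite /L2dist sqE; last exact: L2B.
by rewrite poweR_EFin powR12_sqrt// sq_ge0.
Qed.

Lemma L2dist_le f g (c : R) : L2 P f -> L2 P g -> 0 <= c ->
  (L2dist P f g <= c%:E)%E = (sq (fun w => f w - g w) <= c ^+ 2).
Proof.
move=> Lf Lg c0; rewrite L2distE// lee_fin -[in RHS](sqr_sqrtr (sq_ge0 _)).
by rewrite ler_sqr ?nnegrE ?sqrtr_ge0.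
Qed.

Lemma ae_eq_sq f g : L2 P f -> L2 P g -> ae_equal P f g -> sq f = sq g.
Proof.
move=> [mf _] [mg _] fg; rewrite /sq /Rintegral; congr fine.
apply: ge0_ae_eq_integral => //; try by move=> w _; rewrite lee_fin exprn_ge0.
- exact: measurable_sqr_norm.
- exact: measurable_sqr_norm.
- by apply: filterS fg => w /= -> _.
Qed.

Variable ip : {dot X for idfun}.
Hypothesis ip_norm : forall x : X, ip x x = `|x| ^+ 2.

Lemma integrable_ip f g : L2 P f -> L2 P g -> intg (fun w => ip (f w) (g w)).
Proof.
move=> Lf Lg.
have -> : (fun w => ip (f w) (g w)) = (fun w =>
    2^-1 * (`|f w + g w| ^+ 2 + (-1 * `|f w| ^+ 2 + -1 * `|g w| ^+ 2))).
  by apply/funext => w; rewrite (ip_polar ip_norm); field.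
apply/integrable_mulr/integrable_addr; first exact: L2_integrable (L2D Lf Lg).
by apply: integrable_addr; apply: integrable_mulr; exact: L2_integrable.
Qed.

Lemma sq_young (k : R) f g : L2 P f -> L2 P g -> 0 < k ->
  sq (fun w => f w + g w) <= (1 + k) * sq f + (1 + k^-1) * sq g.
Proof.
move=> Lf Lg k0; have If := L2_integrable Lf; have Ig := L2_integrable Lg.
rewrite -!RintegralZl// -RintegralD//; do ?exact: integrable_mulr.
apply: le_Rintegral => //; first exact: L2_integrable (L2D Lf Lg).
  by apply: integrable_addr; exact: integrable_mulr.
by move=> w _; exact: sqr_normD_young.
Qed.

(* First-order expansion of the square norm along the increment
   [h (W + e)], the cross terms with [V] and [e] absorbed by Young. *)
Lemma sq_increment (a V W e : Omega -> X) (h k k' : R) :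
  L2 P a -> L2 P V -> L2 P W -> L2 P e -> 0 <= h -> 0 < k -> 0 < k' ->
  sq (fun w => a w + h *: (W w + e w)) <=
    sq a + h * (2 * (\int[P]_w ip (W w - V w) (a w))%R +
      (k + k') * sq a + sq V / k + sq e / k') +
    sq (fun w => h *: (W w + e w)).
Proof.
move=> La LV LW Le h0 k0 k'0.
have LD : L2 P (fun w => h *: (W w + e w)) by apply: L2Z; exact: L2D.
have LWV := L2B LW LV.
have Ia := L2_integrable La; have IV := L2_integrable LV.
have Ie := L2_integrable Le; have ID := L2_integrable LD.
have Ip := integrable_ip LWV La.
pose t1 w := 2 * ip (W w - V w) (a w).
pose t2 w := (k + k') * `|a w| ^+ 2.
pose t3 w := k^-1 * `|V w| ^+ 2.
pose t4 w := k'^-1 * `|e w| ^+ 2.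
have I1 : intg t1 by exact: integrable_mulr.
have I2 : intg t2 by exact: integrable_mulr.
have I3 : intg t3 by exact: integrable_mulr.
have I4 : intg t4 by exact: integrable_mulr.
have I12 := integrable_addr I1 I2.
have I123 := integrable_addr I12 I3.
have I1234 := integrable_addr I123 I4.
have Ih := integrable_mulr h I1234.
have Iah := integrable_addr Ia Ih.
have IR := integrable_addr Iah ID.
apply: (@le_trans _ _ (\int[P]_w (`|a w| ^+ 2 + h * (t1 w + t2 w + t3 w + t4 w)
    + `|h *: (W w + e w)| ^+ 2))%R); last first.
  rewrite RintegralD// RintegralD// RintegralZl// RintegralD// RintegralD//.
  by rewrite RintegralD// !RintegralZl// ![_ / _]mulrC.
apply: le_Rintegral => //; first exact: L2_integrable (L2D La LD).
(* The product of [a] with [W] is split into those with [W - V] and with [V]; the former is kept for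
   dissipativity, the latter goes to Young. *)
move=> w _; rewrite (sqr_normD ip_norm) lerD2r lerD2l ipZr mulrCA ler_wpM2l//.
rewrite /t1 /t2 /t3 /t4 ipDr ipBl (ipC _ (W w)).
have := ip_young ip_norm (a w) (V w) k0.
have := ip_young ip_norm (a w) (e w) k'0.
rewrite (ipC ip (a w) (V w)) ![_ / k]mulrC ![_ / k']mulrC.
lra.
Qed.

End L2_calculus.

(** * Dissipativity and short-time estimates *)

Section pushforward_law.
Context {R : realType} (d d' : measure_display).
Context (S : measurableType d) (S' : measurableType d').

(** The definition goes through some measurable representative; a measurable [f] differs from it on
    a null set, which does not affect the measures of preimages. *)
Lemma is_pushforwardE (mu : probability S R) (f : S -> S')
    (nu : probability S' R) : measurable_fun [set: S] f ->
  is_pushforward mu f nu -> forall A, measurable A -> nu A = mu (f @^-1` A).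
Proof.
move=> mf [g [mg fg gE]] A mA; rewrite gE//.
have mfA : measurable (f @^-1` A) by rewrite -[X in measurable X]setTI; exact: mf.
have mgA : measurable (g @^-1` A) by rewrite -[X in measurable X]setTI; exact: mg.
have := fg => -[N [mN N0 sN]].
have le h k : measurable (h @^-1` A) -> measurable (k @^-1` A) ->
    (forall x, ~ N x -> h x = k x) -> (mu (h @^-1` A) <= mu (k @^-1` A))%E.
  move=> mh mk hk; apply: (@le_trans _ _ (mu (k @^-1` A `|` N))).
    apply: le_measure; rewrite ?inE//; first exact: measurableU.
    move=> x hA; have [Nx|Nx] := pselect (N x); first by right.
    by left; rewrite /preimage/= -hk.
  by rewrite measureU0.
have fgN x : ~ N x -> f x = g x.
  by move=> Nx; apply: contrapT => nfg; apply: Nx; exact: sN.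
by apply/eqP; rewrite eq_le !le// => x Nx; rewrite fgN.
Qed.

End pushforward_law.

Section dissipativity.
Context {R : realType} {X : completeNormedModType R} (ip : {dot X for idfun}).
Hypothesis ip_norm : forall x : X, ip x x = `|x| ^+ 2.
Hypothesis X_separable : separable X.
Variables (lam : R) (F : set (Prob (X * X)%type)).
Hypothesis F_dissipative : totally_dissipative ip lam F.
Context (d : measure_display) (Omega : measurableType d).
Variable P : probability Omega R.

Lemma measurable_ip_comp d' (S : measurableType d') (f g : S -> X) :
  measurable_fun [set: S] (f : S -> borel X) ->
  measurable_fun [set: S] (g : S -> borel X) ->
  measurable_fun [set: S] (fun w => ip (f w) (g w)).
Proof.
move=> mf mg.
have -> : (fun w => ip (f w) (g w)) = (fun w =>
    (`|f w + g w| ^+ 2 - `|f w| ^+ 2 - `|g w| ^+ 2) * 2^-1).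
  by apply/funext => w; rewrite (ip_polar ip_norm).
apply: measurable_funM => //; apply: measurable_funB; last first.
  by apply: measurable_funX; exact: measurable_norm.
apply: measurable_funB; apply: measurable_funX; apply: measurable_norm => //.
exact: measurable_borelD.
Qed.

(** The joint law of [(Z, V)] and [(Y, W)] is a coupling of two elements of [F], and total
    dissipativity holds for every coupling, however the two pairs are correlated. *)
Lemma lift_dissipative (Z V Y W : Omega -> X) :
  lift_op P F (Z, V) -> lift_op P F (Y, W) ->
  (\int[P]_w ip (W w - V w) (Y w - Z w))%R <= lam * sq P (fun w => Y w - Z w).
Proof.
move=> [/= LZ LV [Phi0 FPhi0 pPhi0]] [/= LY LW [Phi1 FPhi1 pPhi1]].
have [mZ _] := LZ; have [mV _] := LV; have [mY _] := LY; have [mW _] := LW.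
have sXX := separable_prod X_separable X_separable.
have mZV := measurable_borel_pair X_separable mZ mV.
have mYW := measurable_borel_pair X_separable mY mW.
have mth := measurable_borel_pair sXX mZV mYW.
pose TX : normedModType R := (X * X)%type.
pose theta : Prob (TX * TX)%type := law P mth.
have mfst : measurable_fun [set: borel (TX * TX)%type]
    (fst : borel (TX * TX)%type -> borel TX).
  by apply: continuous_borel_measurable => z; exact: cvg_fst.
have msnd : measurable_fun [set: borel (TX * TX)%type]
    (snd : borel (TX * TX)%type -> borel TX).
  by apply: continuous_borel_measurable => z; exact: cvg_snd.
have coup : couplings Phi0 Phi1 theta.
  split.
    exists fst; split=> //; first exact: aeW.
    by move=> A mA; rewrite (is_pushforwardE mZV pPhi0 mA).
  exists snd; split=> //; first exact: aeW.
  by move=> A mA; rewrite (is_pushforwardE mYW pPhi1 mA).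
have mfst' : measurable_fun [set: borel TX] (fst : borel TX -> borel X).
  by apply: continuous_borel_measurable => z; exact: cvg_fst.
have msnd' : measurable_fun [set: borel TX] (snd : borel TX -> borel X).
  by apply: continuous_borel_measurable => z; exact: cvg_snd.
have m11 := measurableT_comp mfst' mfst; have m12 := measurableT_comp msnd' mfst.
have m21 := measurableT_comp mfst' msnd; have m22 := measurableT_comp msnd' msnd.
have := F_dissipative FPhi0 FPhi1 coup.
rewrite integral_distribution; last 2 first.
- apply/measurable_EFinP; apply: measurable_ip_comp; exact: measurable_borelB.
- exact: (integrable_ip X_separable ip_norm (L2B X_separable LW LV) (L2B X_separable LY LZ)).
rewrite ge0_integral_distribution; last 2 first.
- by apply: measurable_sqr_norm; exact: measurable_borelB.
- by move=> z; rewrite lee_fin exprn_ge0.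
rewrite [X in (_ <= _ * X)%E -> _](sqE (L2B X_separable LY LZ)) -EFinM.
rewrite -[X in (X <= _)%E -> _]fineK ?lee_fin//.
exact: integrable_fin_num (integrable_ip X_separable ip_norm
  (L2B X_separable LW LV) (L2B X_separable LY LZ)).
Qed.

Section short_time.
Variables (Z V : Omega -> X) (x : R -> Omega -> X).
Hypotheses (ZV : lift_op P F (Z, V)) (x_sol : is_solution P F x Z).

Let N t := sq P (fun w => x t w - Z w).

Let LZ : L2 P Z. Proof. by case: ZV. Qed.
Let LV : L2 P V. Proof. by case: ZV. Qed.
Let Lx t : 0 <= t -> L2 P (x t). Proof. by case: x_sol => _ + _ _; exact. Qed.

Lemma solution_lipschitz tau : 0 <= tau -> exists2 L : R, 0 <= L &
  forall s t, 0 <= s <= tau -> 0 <= t <= tau ->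
    sq P (fun w => x s w - x t w) <= L ^+ 2 * (s - t) ^+ 2.
Proof.
move=> tau0; have [_ _ /(_ tau)[L LP] _] := x_sol; exists `|L| => // s t sI tI.
have /andP[s0 _] := sI; have /andP[t0 _] := tI.
have := LP s t sI tI => /(le_trans) H.
have {H} : (L2dist P (x s) (x t) <= (`|L| * `|s - t|)%:E)%E.
  by apply: H; rewrite lee_fin ler_wpM2r// ler_norm.
rewrite L2dist_le ?mulr_ge0//; [|exact: Lx|exact: Lx].
by rewrite exprMn !real_normK ?num_real.
Qed.

Let N0 : N 0 = 0.
Proof.
have [x0 _ _ _] := x_sol.
have -> : N 0 = sq P (fun=> 0 : X).
  apply: ae_eq_sq.
  - by apply: L2B => //; exact: Lx.
  - by have := L2B X_separable LZ LZ; under eq_fun do rewrite subrr.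
  - by apply: filterS x0 => w ->; rewrite subrr.
rewrite /sq; under eq_Rintegral do rewrite normr0 expr0n/=.
by rewrite Rintegral_cst// mul0r.
Qed.

(** By dissipativity and Young, the squared distance [N] to [Z] has slope at most
    [c = (2 * |lam| + k) * M + v / k], with [M] its supremum on [[0, tau]]. Then [M <= c * tau], and
    smallness of [tau] absorbs half of [M] on the left. *)
Lemma short_time tau : 0 < tau -> 8 * `|lam| * tau <= 1 ->
  sq P (fun w => x tau w - Z w) <= 8 * tau ^+ 2 * sq P V.
Proof.
move=> tau0 small; have tau_ge0 := ltW tau0.
have [L L0 LP] := solution_lipschitz tau_ge0.
have I0 : 0 <= (0 : R) <= tau by rewrite lexx.
have x0Z t : 0 <= t -> N t = sq P (fun w => x t w - x 0 w).
  move=> t0; apply: ae_eq_sq; [exact: L2B (Lx t0) LZ| |].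
    by apply: L2B; [|exact: Lx|exact: Lx].
  by have [x0 _ _ _] := x_sol; apply: filterS x0 => w ->.
have Nle t : 0 <= t <= tau -> N t <= L ^+ 2 * tau ^+ 2.
  move=> tI; have /andP[t0 tT] := tI; rewrite x0Z// (le_trans (LP t 0 tI I0))//.
  by rewrite subr0 ler_wpM2l ?exprn_ge0// ler_sqr ?nnegrE.
have Nge t : 0 <= N t by exact: sq_ge0.
pose M := sup [set N t | t in [set t | 0 <= t <= tau]].
have Mne : [set N t | t in [set t | 0 <= t <= tau]] !=set0 by exists (N 0), 0.
have NM t : 0 <= t <= tau -> N t <= M.
  move=> tI; apply: ub_le_sup; last by exists t.
  by exists (L ^+ 2 * tau ^+ 2) => _ [s /= sI <-]; exact: Nle.
have M0 : 0 <= M by rewrite (le_trans (Nge 0))// NM.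
(* With this [k], [c * tau] is at most [M / 4 + M / 4 + 4 * tau ^+ 2 * v], which yields the constant
   8. *)
pose k := (4 * tau)^-1.
have k0 : 0 < k by rewrite invr_gt0 mulr_gt0.
pose v := sq P V; have v0 : 0 <= v by exact: sq_ge0.
pose c := (2 * `|lam| + k) * M + v / k.
have c0 : 0 <= c.
  apply: addr_ge0; last by rewrite divr_ge0// ltW.
  by apply: mulr_ge0 => //; apply: addr_ge0; [exact: mulr_ge0|exact: ltW].
(* A Lipschitz constant of [N], from Young with parameter the time difference, itself at most
   [tau]. *)
pose K := L ^+ 2 * tau ^+ 2 + L ^+ 2 * tau + L ^+ 2.
have K0 : 0 <= K by rewrite !addr_ge0 ?mulr_ge0 ?exprn_ge0.
suff Nc t : 0 <= t <= tau -> N t <= c * t.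
  have Mc : M <= c * tau.
    apply: ge_sup => // _ [t /= tI <-]; rewrite (le_trans (Nc t tI))//.
    by have /andP[_ ?] := tI; rewrite ler_wpM2l.
  have kt : k * tau = 4^-1 by rewrite /k; field; rewrite gt_eqF.
  have vk : v / k = 4 * tau * v by rewrite /k invrK mulrC.
  have : `|lam| * tau * M <= 8^-1 * M by rewrite ler_wpM2r//; lra.
  have := NM tau; rewrite lexx tau_ge0 => /(_ isT); rewrite -/(N tau).
  by move: Mc; rewrite /c mulrDl mulrAC mulrDl kt vk => Mc ? ?; rewrite -/v; nra.
move=> tI; rewrite -[leRHS]add0r -N0.
apply: (@dini_lipschitz_le _ N tau K c c0 K0 _ _ t tI) => [s r sI rI|].
  have [->|rs] := eqVneq r s; first by rewrite !subrr normr0 mulr0.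
  have th0 : 0 < `|r - s| by rewrite normr_gt0 subr_eq0.
  have /andP[s0 sT] := sI; have /andP[r0 rT] := rI.
  have th1 : `|r - s| <= tau by rewrite ler_norml; lra.
  have LsZ := L2B X_separable (Lx s0) LZ.
  have Lrs := L2B X_separable (Lx r0) (Lx s0).
  have := sq_young X_separable ip_norm LsZ Lrs th0.
  rewrite (_ : (fun w => x s w - Z w + (x r w - x s w)) = fun w => x r w - Z w);
    last by apply/funext => w; rewrite addrC subrKA.
  rewrite -/(N r) -/(N s).
  have : (1 + `|r - s|^-1) * sq P (fun w => x r w - x s w) <=
      L ^+ 2 * `|r - s| * (`|r - s| + 1).
    have -> : L ^+ 2 * `|r - s| * (`|r - s| + 1) =
        (1 + `|r - s|^-1) * (L ^+ 2 * (r - s) ^+ 2).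
      by rewrite -(real_normK (num_real (r - s))); field; rewrite gt_eqF.
    by rewrite ler_wpM2l ?addr_ge0 ?invr_ge0// LP.
  have := Nle s sI; have := Nge s; rewrite /K.
  set th := `|r - s| in th0 th1 *; move=> n1 n2 n3 n4.
  have : th * N s <= th * (L ^+ 2 * tau ^+ 2) by rewrite ler_pM2l.
  have : L ^+ 2 * th * th <= L ^+ 2 * th * tau.
    by apply: ler_wpM2l => //; rewrite mulr_ge0 ?exprn_ge0// ltW.
  by lra.
have [_ _ _ [E [mE E0 EP]]] := x_sol; exists E; split=> //.
apply: subset_trans EP => s /= nP dx; apply: nP => /andP[s0 sT] e e0.
have s_ge0 := ltW s0.
have [W sW dW] := dx s0; have [_ /= LW _] := sW.
have LsZ := L2B X_separable (Lx s_ge0) LZ.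
(* The slack [e] is shared in three: [k' * M], the difference quotient error divided by [k']
   (through [eta]), and the quadratic term [L ^+ 2 * h]. *)
pose k' := e / (3 * (M + 1)).
have k'0 : 0 < k' by rewrite divr_gt0// mulr_gt0// ltr_wpDl.
pose eta := Num.sqrt (k' * e / 3).
have eta0 : 0 < eta by rewrite sqrtr_gt0 divr_gt0// mulr_gt0.
have : ereal_nbhs (0 : \bar R) (fun u => u < eta%:E)%E by apply: open_ereal_lt'.
move/dW; rewrite /= /dnbhs => /nbhs_ballP[r1 /= r10 r1P].
pose r := Num.min r1 (e / (3 * (L ^+ 2 + 1))).
have L1 : 0 < L ^+ 2 + 1 by rewrite ltr_wpDl// exprn_ge0.
exists r; first by rewrite lt_min r10/= divr_gt0// mulr_gt0.
move=> h /andP[h0 hr] sh; have h_ge0 := ltW h0.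
move: hr; rewrite lt_min => /andP[hr1 hL].
have sh0 : 0 <= s + h by rewrite addr_ge0.
pose er w := h^-1 *: (x (s + h) w - x s w) - W w.
have Ldq : L2 P (fun w => h^-1 *: (x (s + h) w - x s w)).
  by apply: L2Z; apply: L2B => //; exact: Lx.
have Ler : L2 P er by exact: L2B.
have sqer : sq P er <= k' * e / 3.
  have := r1P h; rewrite -ball_normE/= sub0r normrN gtr0_norm// => /(_ hr1).
  rewrite gt_eqF// => /(_ isT)/ltW; rewrite L2dist_le//; last exact: ltW.
  by rewrite sqr_sqrtr// divr_ge0// mulr_ge0// ltW.
have hWe w : h *: (W w + er w) = x (s + h) w - x s w.
  by rewrite /er addrCA subrr addr0 scalerA divff ?scale1r// gt_eqF.
have := sq_increment X_separable ip_norm LsZ LV LW Ler h_ge0 k0 k'0.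
have eD : (fun w => h *: (W w + er w)) = fun w => x (s + h) w - x s w.
  by apply/funext.
have eN : (fun w => x s w - Z w + h *: (W w + er w)) = fun w => x (s + h) w - Z w.
  by apply/funext => w; rewrite hWe addrC subrKA.
rewrite eD eN -/(N (s + h)) -/(N s).
have sI : 0 <= s <= tau by rewrite s_ge0 ltW.
have shI : 0 <= s + h <= tau by rewrite sh0.
have := LP _ _ shI sI; rewrite (addrC s) addrK.
have := lift_dissipative ZV sW; rewrite -/(N s) -/v.
have := NM s sI; have := Nge s.
set D := sq P (fun w => _ - _).
set Q := (\int[P]_w _)%R => n0 nM dis hD inc.
have lamM : lam * N s <= `|lam| * M.
  by rewrite (le_trans (ler_norm _))// normrM (ger0_norm n0) ler_wpM2l.
have e1 : sq P er / k' <= e / 3.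
  by rewrite ler_pdivrMr// mulrC mulrA.
have e2 : k' * M <= e / 3.
  rewrite /k' (_ : e / (3 * (M + 1)) * M = e / 3 * (M / (M + 1))); last first.
    by field; rewrite gt_eqF// ltr_wpDl.
  rewrite ler_piMr ?divr_ge0 ?(ltW e0)// ler_pdivrMr ?ltr_wpDl// mul1r lerDl//.
have e3 : L ^+ 2 * h <= e / 3.
  move: hL; rewrite invfM mulrA ltr_pdivlMr// => hL.
  by rewrite mulrC (le_trans _ (ltW hL))// ler_wpM2l// lerDl.
have kN : k * N s <= k * M by rewrite ler_pM2l.
have k'N : k' * N s <= k' * M by rewrite ler_pM2l.
rewrite lerBlDr [leRHS]addrC (le_trans inc)// -addrA lerD2l.
rewrite (@le_trans _ _ (h * (2 * Q + (k + k') * N s + v / k + sq P er / k' + L ^+ 2 * h)))//.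
  rewrite [leRHS]mulrDr lerD2l (le_trans hD)//.
  by rewrite expr2 mulrCA.
rewrite ler_wpM2l// /c mulrDl mulrDl; lra.
Qed.

End short_time.
End dissipativity.

(** * Stability of the paths *)

Section laws.
Context {R : realType} (d : measure_display) (Omega : measurableType d).
Variable P : probability Omega R.

Definition has_law d' (S' : measurableType d') (Z : Omega -> S')
    (mu : probability S' R) :=
  measurable_fun [set: Omega] Z /\ forall A, measurable A -> mu A = P (Z @^-1` A).

Lemma has_law_comp d' d'' (S' : measurableType d') (S'' : measurableType d'')
    (Z : Omega -> S') mu (f : S' -> S'') nu :
  measurable_fun [set: S'] f -> has_law Z mu -> is_pushforward mu f nu ->
  has_law (f \o Z) nu.
Proof.
move=> mf [mZ Zmu] fnu; split; first exact: measurableT_comp.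
move=> A mA; rewrite (is_pushforwardE mf fnu mA) Zmu//.
by rewrite -[X in measurable X]setTI; exact: mf.
Qed.

Lemma has_law_integral d' (S' : measurableType d') (Z : Omega -> S')
    (mu : probability S' R) (f : S' -> \bar R) :
  has_law Z mu -> measurable_fun [set: S'] f -> (forall y, 0 <= f y)%E ->
  (\int[mu]_y f y = \int[P]_w f (Z w))%E.
Proof.
move=> [mZ Zmu] mf f0; rewrite -(ge0_integral_law P mZ mf f0).
by apply: eq_measure_integral => A mA _; exact: Zmu.
Qed.

Lemma has_law_ae d' (S' : measurableType d') (Z : Omega -> S')
    (mu : probability S' R) (Q : S' -> Prop) :
  has_law Z mu -> {ae mu, forall x, Q x} -> {ae P, forall w, Q (Z w)}.
Proof.
move=> [mZ Zmu] [N [mN N0 QN]]; exists (Z @^-1` N); split.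
- by rewrite -[X in measurable X]setTI; exact: mZ.
- by rewrite -Zmu.
- by move=> w /= nQ; exact: QN.
Qed.

Lemma has_law_L2 (X : normedModType R) (Z : Omega -> X) (mu : Prob X)
    (f : X -> X) : has_law (Z : Omega -> borel X) mu -> L2 mu f ->
  L2 P (f \o Z) /\ (\int[mu]_x (`|f x| ^+ 2)%:E = (sq P (f \o Z))%:E)%E.
Proof.
move=> Zmu [mf foo]; have [mZ _] := Zmu.
have fE := has_law_integral Zmu (measurable_sqr_norm mf)
  (fun y => ltac:(by rewrite lee_fin exprn_ge0)).
have Lf : L2 P (f \o Z).
  by split; [exact: measurableT_comp mf mZ|rewrite -[X in (X < _)%E]fE].
by split=> //; rewrite fE -sqE.
Qed.

End laws.

Section stability.
Context {R : realType} {X : completeNormedModType R} (ip : {dot X for idfun}).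
Hypothesis ip_norm : forall x : X, ip x x = `|x| ^+ 2.
Hypothesis X_separable : separable X.
Variables (lam : R) (F : set (Prob (X * X)%type)).
Hypothesis F_dissipative : totally_dissipative ip lam F.
Variable fo : Prob X -> X -> X.
Hypothesis fo_minimal :
  forall mu, domain F mu -> is_minimal_selection F mu (fo mu).
Context (d : measure_display) (Omega : measurableType d).
Variable P : probability Omega R.
Variable S : R -> (Omega -> X) -> Omega -> X.
Hypothesis S_semigroup : is_semigroup lam P F S.
Variable s : R -> X -> Prob X -> X.
Hypothesis s_flow : is_lagrangian_flow P F S s.
Variable T : R.
Hypothesis T_gt0 : 0 < T.

(** A bound for [expR (lam * t)] on [[0, T]] whatever the sign of [lam]. *)
Let growth : R := expR (`|lam| * T).

Lemma lift_domain_closureW Z : lift_domain P F Z -> lift_domain_closure P F Z.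
Proof.
move=> ZF; have [V [/= LZ _ _]] := ZF; split=> // e e0; exists Z => //.
apply: (@le_lt_trans _ _ 0%:E); last by rewrite lte_fin.
rewrite (L2dist_le X_separable)// expr0n/= /sq.
by under eq_Rintegral do rewrite subrr normr0 expr0n/=; rewrite Rintegral_cst// mul0r.
Qed.

Lemma semigroup_contraction t Z Y : 0 <= t <= T ->
  lift_domain_closure P F Z -> lift_domain_closure P F Y ->
  sq P (fun w => S t Z w - S t Y w) <=
    growth ^+ 2 * sq P (fun w => Z w - Y w).
Proof.
move=> /andP[t0 tT] ZF YF; have [SF _ _ SK _] := S_semigroup.
have [LZ _] := ZF; have [LY _] := YF.
have [LSZ _] := SF t Z t0 ZF; have [LSY _] := SF t Y t0 YF.
have := SK t Z Y t0 ZF YF; rewrite (L2distE X_separable LZ LY) -EFinM.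
rewrite (L2dist_le X_separable LSZ LSY) ?mulr_ge0 ?expR_ge0 ?sqrtr_ge0//.
rewrite exprMn sqr_sqrtr ?sq_ge0// => /le_trans; apply.
rewrite ler_wpM2r ?sq_ge0// ler_sqr ?nnegrE ?expR_ge0// ler_expR.
by rewrite (le_trans (ler_norm _))// normrM (ger0_norm t0) ler_wpM2l.
Qed.

(** By the semigroup law the increment at [t] is the image under [S t] of the increment at time 0,
    which [short_time] bounds. *)
Lemma semigroup_increment Z V t h : lift_op P F (Z, V) ->
  0 <= t <= T -> 0 <= h -> 8 * `|lam| * h <= 1 ->
  sq P (fun w => S (t + h) Z w - S t Z w) <=
    growth ^+ 2 * (8 * h ^+ 2 * sq P V).
Proof.
move=> ZV tT h0 hsmall; have /andP[t0 _] := tT.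
have ZF : lift_domain P F Z by exists V.
have ZC := lift_domain_closureW ZF.
have [SF _ Sadd _ /(_ _ ZF)[sol _]] := S_semigroup.
have [LSh _] := SF h Z h0 ZC; have [LSt _] := SF t Z t0 ZC.
have [LSth _] := SF (t + h) Z (addr_ge0 t0 h0) ZC.
have [LStSh _] := SF t _ t0 (SF h Z h0 ZC).
have -> : sq P (fun w => S (t + h) Z w - S t Z w) =
    sq P (fun w => S t (S h Z) w - S t Z w).
  apply: ae_eq_sq; [exact: L2B|exact: L2B|].
  by apply: filterS (Sadd t h Z t0 h0 ZC) => w ->.
apply: le_trans (semigroup_contraction tT (SF h Z h0 ZC) ZC) _.
rewrite ler_wpM2l ?exprn_ge0 ?expR_ge0//.
have [h00|hneq0] := eqVneq h 0; last first.
  by apply: (short_time ip_norm X_separable F_dissipative ZV sol) => //;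
    rewrite lt_neqAle eq_sym hneq0.
have [LZ _] := ZC; have [S0 _ _ _] := sol.
rewrite h00 expr0n/= mulr0 mul0r.
have -> : sq P (fun w => S 0 Z w - Z w) = sq P (fun=> 0 : X).
  apply: ae_eq_sq.
  - by apply: L2B => //; rewrite -h00.
  - by have := L2B X_separable LZ LZ; under eq_fun do rewrite subrr.
  - by apply: filterS S0 => w ->; rewrite subrr.
by rewrite /sq; under eq_Rintegral do rewrite normr0 expr0n/=; rewrite Rintegral_cst// mul0r.
Qed.

Section path.
Variables (mu : Prob X) (g : X -> cpath T X) (Z : Omega -> X).
Hypothesis mu_dom : domain F mu.
Hypothesis mu_P2 : P2 mu.
Hypothesis mg : measurable_fun [set: borel X] (g : borel X -> borel (cpath T X)).
Hypothesis g_flow : {ae mu, forall x, forall t : set_type `[0, T]%classic,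
  g x t = s (set_val t) x mu}.
Hypothesis Z_law : has_law P (Z : Omega -> borel X) mu.

(** Composing the minimal selection with [Z] gives a velocity whose norm depends on the law [mu]
    only, so bounds on laws become bounds on [Omega]. *)
Lemma has_law_lift : exists V, lift_op P F (Z, V) /\
  mpvf_norm2 fo mu = (sq P V)%:E.
Proof.
have [Lfo [Phi [FPhi _] pPhi] _] := fo_minimal mu_dom.
have [LV Vnorm] := has_law_L2 Z_law Lfo; have [mfo _] := Lfo.
have [mZ _] := Z_law.
have mid : measurable_fun [set: borel X] (id : borel X -> borel X).
  exact: measurable_id.
have [LZ _] : L2 P (id \o Z) /\ _ := has_law_L2 Z_law (conj mid mu_P2).
exists (fo mu \o Z); split=> //; split=> //=; exists Phi => //.
have mpair := measurable_borel_pair X_separable mid mfo.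
have [mZV ZVPhi] := has_law_comp mpair Z_law pPhi.
by exists (fun w => (Z w, fo mu (Z w))); split=> //; exact: aeW.
Qed.

Lemma lift_domain_law : lift_domain P F Z.
Proof. by have [V [ZV _]] := has_law_lift; exists V. Qed.

Let ZC : lift_domain_closure P F Z := lift_domain_closureW lift_domain_law.

(** The null set may depend on [r]; this suffices because each integral in the chaining hypotheses
    involves at most two times. *)
Lemma flow_path r : 0 <= r <= T ->
  {ae P, forall w, valL (g (Z w)) r = S r Z w}.
Proof.
move=> rT; have /andP[r0 _] := rT; have [t tr fE] := valL_itv X rT.
have [mZ Zmu] := Z_law.
have pZ : is_pushforward P (Z : Omega -> borel X) mu.
  by exists Z; split=> //; exact: aeW.
have gZ := has_law_ae Z_law g_flow.
have SZ := s_flow.2 r Z mu r0 ZC pZ.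
by apply: filterS2 gZ SZ => w gw ->; rewrite fE gw tr.
Qed.

End path.

Lemma measurable_sqr_ae (f g : Omega -> X) : L2 P g ->
  measurable_fun [set: Omega] (f : Omega -> borel X) ->
  {ae P, forall w, f w = g w} ->
  (\int[P]_w (`|f w| ^+ 2)%:E = (sq P g)%:E)%E.
Proof.
move=> Lg mf fg; have [mg' _] := Lg; rewrite -sqE//.
apply: ge0_ae_eq_integral => //; [exact: measurable_sqr_norm..|].
by apply: filterS fg => w /= -> _.
Qed.

Lemma sq_sub_le (f g : Omega -> X) : L2 P f -> L2 P g ->
  sq P (fun w => f w - g w) <= 2 * sq P f + 2 * sq P g.
Proof.
move=> Lf Lg; have := sq_young X_separable ip_norm Lf (L2Z (-1) Lg) ltr01.
under [X in sq P X <= _]eq_fun do rewrite scaleN1r.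
rewrite (_ : sq P (fun w => -1 *: g w) = sq P g); last first.
  by rewrite /sq; apply: eq_Rintegral => w _; rewrite scaleN1r normrN.
by rewrite invr1.
Qed.

Lemma path_sqr_norm_finite (mu : Prob X) (g : X -> cpath T X) (Z : Omega -> X) :
  domain F mu -> P2 mu ->
  measurable_fun [set: borel X] (g : borel X -> borel (cpath T X)) ->
  {ae mu, forall x, forall t : set_type `[0, T]%classic,
    g x t = s (set_val t) x mu} ->
  has_law P (Z : Omega -> borel X) mu ->
  (\int[P]_w (`|g (Z w)| ^+ 2)%:E < +oo)%E.
Proof.
move=> muD muP2 mg gflow Zlaw.
have ZF := lift_domain_law muD muP2 Zlaw; have ZC := lift_domain_closureW ZF.
have [mZ _] := Zlaw; have [LZ _] := ZC.
have [SF _ _ _ /(_ _ ZF)[sol _]] := S_semigroup.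
have LS r : 0 <= r -> L2 P (S r Z) by move=> r0; have [] := SF r Z r0 ZC.
have [L L0 LP] := solution_lipschitz X_separable sol (ltW T_gt0).
have mh : measurable_fun [set: Omega] (g \o Z : Omega -> borel (cpath T X)).
  exact: measurableT_comp mg mZ.
have S00 : 0 <= (0 : R) <= T by rewrite lexx ltW.
pose A := 2 * (L ^+ 2 * T ^+ 2) + 2 * sq P (S 0 Z).
have A0 : 0 <= A by rewrite addr_ge0 ?mulr_ge0 ?exprn_ge0 ?sq_ge0 ?(ltW T_gt0).
have path r := flow_path muD muP2 gflow Zlaw (r := r).
(* For mere finiteness the coarsest level 0 and the Lipschitz constant of this one solution are
   enough. *)
have := @cpath_chaining _ _ _ T_gt0 X_separable _ _ P (g \o Z) A (L ^+ 2) T 0 mh A0.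
rewrite exprn_ge0// => /(_ isT); rewrite expr0 divr1 lexx => /(_ isT) H.
apply: le_lt_trans (H _ _) _; last by rewrite ltry.
- move=> r rT; have /andP[r0 rleT] := rT.
  rewrite (measurable_sqr_ae (LS r r0) _ (path r rT)); last exact: measurable_valL.
  rewrite lee_fin; have Ld := L2B X_separable (LS r r0) (LS 0 (lexx _)).
  have := sq_young X_separable ip_norm Ld (LS 0 (lexx _)) ltr01.
  rewrite (_ : (fun w => _) = S r Z); last by apply/funext => w; rewrite subrK.
  move/le_trans; apply; rewrite invr1 -[1 + 1]/(2%:R) /A lerD2r ler_wpM2l//.
  rewrite (le_trans (LP r 0 rT S00))// subr0 ler_wpM2l ?exprn_ge0//.
  by rewrite ler_sqr ?nnegrE// ltW.
- move=> r r' rT rT' _; have /andP[r0 _] := rT; have /andP[r0' _] := rT'.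
  rewrite (@measurable_sqr_ae _ (fun w => S r' Z w - S r Z w)).
  + by rewrite lee_fin LP.
  + by apply: L2B => //; exact: LS.
  + by apply: measurable_borelB => //; exact: measurable_valL.
  + by apply: filterS2 (path r rT) (path r' rT') => w -> ->.
Qed.

Lemma valL_cpathB (f g : cpath T X) r : 0 <= r <= T ->
  valL (f - g) r = valL f r - valL g r.
Proof. by move=> rT; have [t _ fE] := valL_itv X rT; rewrite !fE. Qed.

(* The cost of transporting the paths: the values at [2^m] times are controlled
   by the contraction of the semigroup, the oscillation in between by [v]. *)
Lemma path_sqr_dist_le (mu nu : Prob X) (g k : X -> cpath T X)
    (Z Y : Omega -> X) (v : R) m :
  domain F mu -> P2 mu -> domain F nu -> P2 nu ->
  measurable_fun [set: borel X] (g : borel X -> borel (cpath T X)) ->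
  measurable_fun [set: borel X] (k : borel X -> borel (cpath T X)) ->
  {ae mu, forall x, forall t : set_type `[0, T]%classic,
    g x t = s (set_val t) x mu} ->
  {ae nu, forall x, forall t : set_type `[0, T]%classic,
    k x t = s (set_val t) x nu} ->
  has_law P (Z : Omega -> borel X) mu -> has_law P (Y : Omega -> borel X) nu ->
  (mpvf_norm2 fo mu <= v%:E)%E -> (mpvf_norm2 fo nu <= v%:E)%E ->
  8 * `|lam| * (T / 2 ^+ m) <= 1 ->
  (\int[P]_w (`|g (Z w) - k (Y w)| ^+ 2)%:E <=
    (2 * (2 ^+ m + 1) * (growth ^+ 2 * sq P (fun w => Z w - Y w)) +
     12 * (32 * growth ^+ 2 * v) * T ^+ 2 / 2 ^+ m)%:E)%E.
Proof.
move=> muD muP2 nuD nuP2 mg mk gflow kflow Zlaw Ylaw muv nuv msmall.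
have [mZ _] := Zlaw; have [mY _] := Ylaw.
have [V [ZV Vmu]] := has_law_lift muD muP2 Zlaw.
have [W [YW Wnu]] := has_law_lift nuD nuP2 Ylaw.
have ZC := lift_domain_closureW (lift_domain_law muD muP2 Zlaw).
have YC := lift_domain_closureW (lift_domain_law nuD nuP2 Ylaw).
have pZ r := flow_path muD muP2 gflow Zlaw (r := r).
have pY r := flow_path nuD nuP2 kflow Ylaw (r := r).
have [SF _ _ _ _] := S_semigroup.
have LZ r : 0 <= r -> L2 P (S r Z) by move=> r0; have [] := SF r Z r0 ZC.
have LY r : 0 <= r -> L2 P (S r Y) by move=> r0; have [] := SF r Y r0 YC.
have Vv : sq P V <= v by rewrite -lee_fin -Vmu.
have Wv : sq P W <= v by rewrite -lee_fin -Wnu.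
have v0 : 0 <= v by rewrite (le_trans _ Vv)// sq_ge0.
have E0 : 0 <= growth ^+ 2 by rewrite exprn_ge0// expR_ge0.
have mh : measurable_fun [set: Omega]
    (fun w => g (Z w) - k (Y w) : borel (cpath T X)).
  apply: measurable_borelB; first exact: separable_cpath.
  - exact: measurableT_comp mg mZ.
  - exact: measurableT_comp mk mY.
apply: (cpath_chaining T_gt0 X_separable (h0 := T / 2 ^+ m) mh) => //.
- by rewrite mulr_ge0// sq_ge0.
- by rewrite mulr_ge0// mulr_ge0.
- move=> r rT; have /andP[r0 _] := rT.
  rewrite (@measurable_sqr_ae _ (fun w => S r Z w - S r Y w)).
  + by rewrite lee_fin semigroup_contraction.
  + by apply: L2B => //; [exact: LZ|exact: LY].
  + exact: measurable_valL.
  + apply: filterS2 (pZ r rT) (pY r rT) => w Zw Yw.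
    by rewrite valL_cpathB// Zw Yw.
(* No cancellation between the two increments is used: each contributes twice its bound
   [8 * growth ^+ 2 * v], hence 32. *)
move=> r r' rT rT' /andP[rr' hm]; have /andP[r0 _] := rT; have /andP[r0' _] := rT'.
rewrite (@measurable_sqr_ae _
    (fun w => (S r' Z w - S r Z w) - (S r' Y w - S r Y w))).
- rewrite lee_fin.
  have LdZ := L2B X_separable (LZ r' r0') (LZ r r0).
  have LdY := L2B X_separable (LY r' r0') (LY r r0).
  rewrite (le_trans (sq_sub_le LdZ LdY))//.
  have hsmall : 8 * `|lam| * (r' - r) <= 1.
    by rewrite (le_trans _ msmall)// ler_wpM2l// mulr_ge0.
  have := semigroup_increment ZV rT rr' hsmall.
  have := semigroup_increment YW rT rr' hsmall; rewrite !subrKC.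
  have le (u : R) : u <= v -> growth ^+ 2 * (8 * (r' - r) ^+ 2 * u) <=
      growth ^+ 2 * (8 * (r' - r) ^+ 2 * v).
    by move=> uv; rewrite ler_wpM2l// ler_wpM2l// mulr_ge0// exprn_ge0.
  have := le _ Vv; have := le _ Wv.
  by lra.
- by apply: L2B => //; apply: L2B => //; [exact: LZ|exact: LZ|exact: LY|exact: LY].
- by apply: measurable_borelB => //; exact: measurable_valL.
- apply: filterS2 (filterI (pZ r rT) (pZ r' rT')) (filterI (pY r rT) (pY r' rT')).
  by move=> w [Zr Zr'] [Yr Yr']; rewrite !valL_cpathB// Zr Zr' Yr Yr' !opprD !opprK addrACA.
Qed.

End stability.

(** * Convergence of the laws *)

Lemma ae_mono {R : realType} d (S : measurableType d) (mu : probability S R)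
    (Q1 Q2 : S -> Prop) : (forall x, Q1 x -> Q2 x) ->
  {ae mu, forall x, Q1 x} -> {ae mu, forall x, Q2 x}.
Proof. by move=> Q12; apply: filterS. Qed.

Lemma ae_mono2 {R : realType} d (S : measurableType d) (mu : probability S R)
    (Q1 Q2 Q3 : S -> Prop) : (forall x, Q1 x -> Q2 x -> Q3 x) ->
  {ae mu, forall x, Q1 x} -> {ae mu, forall x, Q2 x} ->
  {ae mu, forall x, Q3 x}.
Proof. by move=> Q123; apply: filterS2. Qed.

Section wasserstein_bounds.
Context {R : realType} (Y : normedModType R).
Implicit Types mu nu : Prob Y.

Lemma W2_lt_coupling mu nu (c : R) : 0 <= c ->
  (W2 mu nu < (Num.sqrt c)%:E)%E -> exists2 gamma, couplings mu nu gamma &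
    (\int[gamma]_z (`|(z : Y * Y).1 - (z : Y * Y).2| ^+ 2)%:E < c%:E)%E.
Proof.
move=> c0; rewrite /W2; set I := ereal_inf _ => Ic.
have I0 : (0 <= I)%E.
  apply/ereal_infP => _ [gamma _ <-].
  by apply: integral_ge0 => z _; rewrite lee_fin exprn_ge0.
have /ereal_inf_lt[_ [gamma gc <-] cost] : (I < c%:E)%E.
  rewrite ltNge; apply/negP => cI; move: Ic; rewrite ltNge => /negP; apply.
  rewrite -powR12_sqrt// -poweR_EFin; apply: gt0_ler_poweR => //.
  - by rewrite in_itv/= lee_fin c0 leey.
  - by rewrite in_itv/= I0 leey.
by exists gamma.
Qed.

Lemma W2_le_coupling mu nu gamma (c : R) : 0 <= c -> couplings mu nu gamma ->
  (\int[gamma]_z (`|(z : Y * Y).1 - (z : Y * Y).2| ^+ 2)%:E <= c%:E)%E ->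
  (W2 mu nu <= (Num.sqrt c)%:E)%E.
Proof.
move=> c0 gc cost; rewrite /W2; set I := ereal_inf _.
have I0 : (0 <= I)%E.
  apply/ereal_infP => _ [gamma' _ <-].
  by apply: integral_ge0 => z _; rewrite lee_fin exprn_ge0.
have Ic : (I <= c%:E)%E by apply: le_trans cost; apply: ereal_inf_lbound; exists gamma.
rewrite -powR12_sqrt// -poweR_EFin; apply: gt0_ler_poweR => //.
- by rewrite in_itv/= I0 leey.
- by rewrite in_itv/= lee_fin c0 leey.
Qed.

Lemma cvg_W2_0 (mu_ : nat -> Prob Y) mu :
  (forall e : R, 0 < e ->
    \forall n \near \oo, (W2 (mu_ n) mu <= e%:E)%E) ->
  W2 (mu_ n) mu @[n --> \oo] --> 0%E.
Proof.
move=> W2e; have W0 n : (0 <= W2 (mu_ n) mu)%E by exact: poweR_ge0.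
apply/fine_cvgP; split.
  apply: filterS (W2e 1 ltr01) => n W1; rewrite ge0_fin_numE//.
  by rewrite (le_lt_trans W1)// ltry.
apply/cvgrPdist_le => e e0; apply: filterS (W2e e e0) => n We.
rewrite sub0r normrN ger0_norm ?fine_ge0//.
by rewrite -lee_fin fineK// ge0_fin_numE// (le_lt_trans We)// ltry.
Qed.

End wasserstein_bounds.

Lemma sqr_max_le {R : realType} (a b : R) : 0 <= a -> 0 <= b ->
  Num.max a b ^+ 2 <= a ^+ 2 + b ^+ 2.
Proof.
move=> a0 b0; have [_|_] := leP a b; first by rewrite lerDr exprn_ge0.
by rewrite lerDl exprn_ge0.
Qed.

Lemma ge0_integral_prod_norm_le {R : realType} d (Omega : measurableType d)
    (P : probability Omega R) (X Y : normedModType R)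
    (f : Omega -> X) (g : Omega -> Y) :
  measurable_fun [set: Omega] (f : Omega -> borel X) ->
  measurable_fun [set: Omega] (g : Omega -> borel Y) ->
  (\int[P]_w (Num.max `|f w| `|g w| ^+ 2)%:E <=
   \int[P]_w (`|f w| ^+ 2)%:E + \int[P]_w (`|g w| ^+ 2)%:E)%E.
Proof.
move=> mf mg; have mf2 := measurable_sqr_norm mf; have mg2 := measurable_sqr_norm mg.
rewrite -ge0_integralD//; try by move=> w _; rewrite lee_fin exprn_ge0.
apply: ge0_le_integral => //.
- apply/measurable_EFinP; apply: measurable_funX; apply: measurable_maxr;
    exact: measurable_norm.
- exact: emeasurable_funD.
- by move=> w _; rewrite -EFinD lee_fin sqr_max_le.
Qed.

Theorem theorem4p9 (R : realType) (X : completeNormedModType R)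
    (ip : {dot X for idfun})
    (ip_norm : forall x : X, ip x x = `|x| ^+ 2)
    (X_separable : separable X)
    (lam : R) (F : set (Prob (X * X)%type))
    (F_maximal : maximal_totally_dissipative ip lam F)
    (fo : Prob X -> X -> X)
    (fo_minimal : forall mu, domain F mu -> is_minimal_selection F mu (fo mu))
    (d : measure_display) (Omega : measurableType d) (P : probability Omega R)
    (Omega_standard : standard_borel (R := R) Omega)
    (P_nonatomic : nonatomic P)
    (S : R -> (Omega -> X) -> Omega -> X) (S_semigroup : is_semigroup lam P F S)
    (s : R -> X -> Prob X -> X) (s_flow : is_lagrangian_flow P F S s)
    (T : R) (T_gt0 : 0 < T)
    (mu0 : Prob X) (mu0_dom : domain F mu0)
    (mu0_ : nat -> Prob X) (mu0_n_dom : forall n, domain F (mu0_ n))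
    (mu0_n_cvg : cvg_P2 mu0_ mu0)
    (mu0_n_bounded :
      (ereal_sup (range (fun n => mpvf_norm2 fo (mu0_ n))) < +oo)%E)
    (s_ : nat -> X -> cpath T X)
    (s_n_map : forall n, is_lagrangian_map s (mu0_ n) (s_ n))
    (s_0 : X -> cpath T X) (s_0_map : is_lagrangian_map s mu0 s_0) :
  exists (nu_ : nat -> Prob (X * cpath T X)%type)
         (nu : Prob (X * cpath T X)%type),
    [/\ forall n, is_pushforward (mu0_ n)
          (fun x => (x, s_ n x) : borel (X * cpath T X)%type) (nu_ n),
        is_pushforward mu0
          (fun x => (x, s_0 x) : borel (X * cpath T X)%type) nu &
        cvg_P2 nu_ nu].
Proof.
have [[F_ne F_P2] F_diss _] := F_maximal.
have [mu_P2 mu0_P2 mu_cvg] := mu0_n_cvg.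
have X_X_separable := separable_prod X_separable X_separable.
have C_separable := separable_cpath T X_separable.
have XC_separable := separable_prod X_separable C_separable.
(* Lagrangian maps are only almost everywhere measurable, so Borel representatives are fixed before
   forming graphs and laws. *)
have /choice[g gP] n : exists g : X -> cpath T X,
    measurable_fun [set: borel X] (g : borel X -> borel (cpath T X)) /\
    {ae mu0_ n, forall x, s_ n x = g x}.
  by have [[g mg sg] _] := s_n_map n; exists g.
have [[g0 mg0 sg0] s0_flow] := s_0_map.
have mg n : measurable_fun [set: borel X] (g n : borel X -> borel (cpath T X)).
  by have [] := gP n.
have g_flow n : {ae mu0_ n, forall x, forall t : set_type `[0, T]%classic,
    g n x t = s (set_val t) x (mu0_ n)}.
  have [_ sg] := gP n; have [_ s_flow'] := s_n_map n.
  by apply: ae_mono2 sg s_flow' => x <-.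
have g0_flow : {ae mu0, forall x, forall t : set_type `[0, T]%classic,
    g0 x t = s (set_val t) x mu0}.
  by apply: ae_mono2 sg0 s0_flow => x <-.
have mid : measurable_fun [set: borel X] (id : borel X -> borel X).
  exact: measurable_id.
pose graph (f : X -> cpath T X) (x : borel X) : borel (X * cpath T X)%type :=
  (x : X, f x).
have mgraph f : measurable_fun [set: borel X] (f : borel X -> borel (cpath T X)) ->
    measurable_fun [set: borel X] (graph f).
  by move=> mf; exact: measurable_borel_pair X_separable mid mf.
pose nu_ n := law (mu0_ n) (mgraph _ (mg n)).
pose nu := law mu0 (mgraph _ mg0).
have real_law (mu : Prob X) : exists2 Z : Omega -> X, True &
    has_law P (Z : Omega -> borel X) mu.
  by have [Z mZ Zmu] := nonatomic_realization P_nonatomic mu X_separable; exists Z.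
have P2_graph (mu : Prob X) (f : X -> cpath T X) (mf : measurable_fun [set: borel X]
      (f : borel X -> borel (cpath T X))) : domain F mu -> P2 mu ->
    {ae mu, forall x, forall t : set_type `[0, T]%classic,
      f x t = s (set_val t) x mu} ->
    @P2 R (X * cpath T X)%type (law mu (mgraph _ mf)).
  move=> muD muP2 fflow; have [Z _ Zlaw] := real_law mu; rewrite /P2/=.
  rewrite ge0_integral_law; last 2 first.
  - by apply: measurable_sqr_norm; exact: measurable_id.
  - by move=> y; rewrite lee_fin exprn_ge0.
  under eq_integral do rewrite prod_normE/=.
  apply: le_lt_trans (ge0_integral_prod_norm_le mu mid mf) _.
  rewrite lte_add_pinfty//.
  rewrite (has_law_integral Zlaw (measurable_sqr_norm mf)); last first.
    by move=> y; rewrite lee_fin exprn_ge0.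
  exact: (path_sqr_norm_finite ip_norm X_separable fo_minimal S_semigroup s_flow
    T_gt0 muD muP2 mf fflow Zlaw).
exists nu_, nu; split.
- move=> n; have [_ sg] := gP n; exists (graph (g n)); split=> //.
    exact: (mgraph _ (mg n)).
  by apply: ae_mono sg => x ->.
- exists (graph g0); split=> //; first exact: (mgraph _ mg0).
  by apply: ae_mono sg0 => x ->.
split; first by move=> n; exact: P2_graph.
  exact: P2_graph.
apply: cvg_W2_0 => e e0.
have [v v0 [vn v_0]] : exists2 v : R, 0 <= v &
    (forall n, (mpvf_norm2 fo (mu0_ n) <= v%:E)%E) /\ (mpvf_norm2 fo mu0 <= v%:E)%E.
  have norm_ge0 mu : (0 <= mpvf_norm2 fo mu)%E.
    by apply: integral_ge0 => x _; rewrite lee_fin exprn_ge0.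
  have [[_ fo0] _ _] := fo_minimal mu0 mu0_dom.
  pose b := ereal_sup (range (fun n => mpvf_norm2 fo (mu0_ n))).
  have nb n : (mpvf_norm2 fo (mu0_ n) <= b)%E by apply: ereal_sup_ubound; exists n.
  have b0 : (0 <= b)%E by exact: le_trans (nb 0%N).
  exists (fine b + fine (mpvf_norm2 fo mu0)).
    by rewrite addr_ge0// fine_ge0.
  have fb : b \is a fin_num by rewrite ge0_fin_numE.
  have f0 : mpvf_norm2 fo mu0 \is a fin_num by rewrite ge0_fin_numE.
  rewrite EFinD !fineK//; split=> [n|]; last by rewrite leeDr.
  by rewrite (le_trans (nb n))// leeDl.
pose E2 : R := expR (`|lam| * T) ^+ 2.
have E20 : 0 <= E2 by rewrite exprn_ge0// expR_ge0.
pose c := 12 * (32 * E2 * v) * T ^+ 2.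
have c0 : 0 <= c by rewrite !mulr_ge0 ?(ltW T_gt0).
have [m [m_small mc]] : exists m, 8 * `|lam| * (T / 2 ^+ m) <= 1 /\
    c / 2 ^+ m <= e ^+ 2 / 2.
  (* The first term makes the grid step admissible for [short_time], the second makes the
     oscillation cost at most [e ^+ 2 / 2]. *)
  pose a := 8 * `|lam| * T + 2 * c / e ^+ 2.
  have e20 : 0 < e ^+ 2 by rewrite exprn_gt0.
  have lT0 : 0 <= 8 * `|lam| * T by rewrite !mulr_ge0// ltW.
  have ce0 : 0 <= 2 * c / e ^+ 2 by rewrite divr_ge0 ?mulr_ge0// ltW.
  have a0 : 0 <= a by rewrite addr_ge0.
  exists (Num.bound a); have m0 : 0 < 2 ^+ Num.bound a :> R by rewrite exprn_gt0.
  have am : a <= 2 ^+ Num.bound a.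
    rewrite (le_trans (ltW (archi_boundP a0)))// -natrX ler_nat.
    by rewrite ltnW// ltn_expl.
  split.
    rewrite mulrA ler_pdivrMr// mul1r (le_trans _ am)// /a lerDl//.
  have : 2 * c / e ^+ 2 <= 2 ^+ Num.bound a by rewrite (le_trans _ am)// /a lerDr.
  by rewrite ler_pdivrMr// ler_pdivrMr//; lra.
(* The 1 accounts for the component in [X], the rest for the grid cost of the paths. As [m] is now
   fixed, [delta] does not depend on [n]. *)
pose q := 1 + 2 * (2 ^+ m + 1) * E2.
have q0 : 0 < q by rewrite ltr_wpDr// !mulr_ge0// addr_ge0// exprn_ge0.
pose delta := e ^+ 2 / 2 / q.
have delta0 : 0 < delta by rewrite !divr_gt0// exprn_gt0.
have dpos : (0 < (Num.sqrt delta)%:E)%E by rewrite lte_fin sqrtr_gt0.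
have Wlt : \forall n \near \oo, (W2 (mu0_ n) mu0 < (Num.sqrt delta)%:E)%E.
  exact: (mu_cvg _ (open_ereal_lt' dpos)).
apply: filterS Wlt => n /(W2_lt_coupling (ltW delta0))[gamma [gmu gmu0] gcost].
(* The pair is realized jointly, so the transport cost of [gamma] becomes a squared distance in the
   space where the semigroup contracts. *)
have [ZY mZY ZYgamma] := @nonatomic_realization _ _ _ P P_nonatomic
  (X * X)%type gamma X_X_separable.
have ZY_law : has_law P (ZY : Omega -> borel (X * X)%type) gamma by split.
have mfst : measurable_fun [set: borel (X * X)%type]
    (fst : borel (X * X)%type -> borel X).
  by apply: continuous_borel_measurable => z; exact: cvg_fst.
have msnd : measurable_fun [set: borel (X * X)%type]
    (snd : borel (X * X)%type -> borel X).
  by apply: continuous_borel_measurable => z; exact: cvg_snd.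
pose Z w := (ZY w).1; pose Y w := (ZY w).2.
have Z_law : has_law P (Z : Omega -> borel X) (mu0_ n).
  exact: has_law_comp mfst ZY_law gmu.
have Y_law : has_law P (Y : Omega -> borel X) mu0.
  exact: has_law_comp msnd ZY_law gmu0.
have [mZ _] := Z_law; have [mY _] := Y_law.
have LZ : L2 P Z by have [] := has_law_L2 Z_law (conj mid (mu_P2 n)).
have LY : L2 P Y by have [] := has_law_L2 Y_law (conj mid mu0_P2).
have costZY : sq P (fun w => Z w - Y w) <= delta.
  rewrite -lee_fin -(sqE (L2B X_separable LZ LY)) ltW//.
  rewrite (has_law_integral ZY_law) in gcost; first exact: gcost.
    by apply: measurable_sqr_norm; exact: measurable_borelB.
  by move=> z; rewrite lee_fin exprn_ge0.
have path_cost := path_sqr_dist_le ip_norm X_separable F_diss fo_minimal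
  S_semigroup s_flow T_gt0 (mu0_n_dom n) (mu_P2 n) mu0_dom mu0_P2 (mg n) mg0
  (g_flow n) g0_flow Z_law Y_law (vn n) v_0 m_small.
have mgZ := measurableT_comp (mgraph _ (mg n)) mZ.
have mgY := measurableT_comp (mgraph _ mg0) mY.
(* The joint law of the two graphs evaluated at [Z] and [Y] is the competitor in the Wasserstein
   distance of the path laws. *)
have mtheta := measurable_borel_pair XC_separable mgZ mgY.
pose XC : normedModType R := (X * cpath T X)%type.
pose theta : Prob (XC * XC)%type := law P mtheta.
have coup : couplings (nu_ n) nu theta.
  have law_theta : has_law P (fun w => (graph (g n) (Z w), graph g0 (Y w)) :
      borel (XC * XC)%type) theta by split.
  split.
    exists fst; split=> //; [|exact: aeW|].
      by apply: continuous_borel_measurable => z; exact: cvg_fst.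
    move=> A mA; rewrite [LHS]Z_law.2//.
    by rewrite -[X in measurable X]setTI; exact: (mgraph _ (mg n)).
  exists snd; split=> //; [|exact: aeW|].
    by apply: continuous_borel_measurable => z; exact: cvg_snd.
  move=> A mA; rewrite [LHS]Y_law.2//.
  by rewrite -[X in measurable X]setTI; exact: (mgraph _ mg0).
rewrite -[e]ger0_norm ?(ltW e0)// -sqrtr_sqr.
apply: W2_le_coupling coup _; first by rewrite exprn_ge0// ltW.
have mfstXC : measurable_fun [set: borel (XC * XC)%type]
    (fst : borel (XC * XC)%type -> borel XC).
  by apply: continuous_borel_measurable => z; exact: cvg_fst.
have msndXC : measurable_fun [set: borel (XC * XC)%type]
    (snd : borel (XC * XC)%type -> borel XC).
  by apply: continuous_borel_measurable => z; exact: cvg_snd.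
rewrite ge0_integral_law; last 2 first.
- by apply: measurable_sqr_norm; exact: measurable_borelB.
- by move=> z; rewrite lee_fin exprn_ge0.
under eq_integral do rewrite prod_normE/=.
have mZY' := measurable_borelB X_separable mZ mY.
have mgg : measurable_fun [set: Omega]
    (fun w => g n (Z w) - g0 (Y w) : borel (cpath T X)).
  apply: measurable_borelB => //.
  - exact: measurableT_comp (mg n) mZ.
  - exact: measurableT_comp mg0 mY.
apply: le_trans (ge0_integral_prod_norm_le P mZY' mgg) _.
rewrite (sqE (L2B X_separable LZ LY)).
apply: le_trans (leeD (lexx _) path_cost) _; rewrite -EFinD lee_fin.
rewrite -/E2 -/c.
set a := sq _ _ in costZY *.
have : q * a <= e ^+ 2 / 2.
  by rewrite mulrC -ler_pdivlMr.
by move: mc; rewrite /q; lra.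
Qed.
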